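(* Let $\mathfrak{k}=[k_1,k_2,k_3,k_4]$ be a tuple of (finite) integers with $k_i\geq 4$ for all $i$ and $\vartheta(\mathfrak{k})\geq 2$. Then there exists a pseudo-homogeneous tiling of the plane of type $\mathfrak{k}$.
   Context: A tiling of the plane is a locally finite edge-to-edge decomposition of the plane into topological polygons (closed discs with finitely many, possibly curved, sides); the size of a face is its number of sides. The type of a vertex is the cyclic sequence of sizes of the faces incident to it (up to reversal). A tiling is pseudo-homogeneous if all vertex types are the same up to a permutation of the entries; its type is then the unordered tuple (multiset) $\mathfrak{k}=[k_1,\dots,k_d]$ of sizes of the faces around each vertex. The angle-sum of $\mathfrak{k}=[k_1,\dots,k_d]$ is $\vartheta(\mathfrak{k})=\sum_{i=1}^d \frac{k_i-2}{k_i}$. *)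

(* Defs.v *)
From HB Require Import structures.
From mathcomp Require Import all_boot all_order all_algebra.
From mathcomp Require Import all_classical all_reals all_analysis.

Set Implicit Arguments.
Unset Strict Implicit.
Unset Printing Implicit Defensive.

Import Order.TTheory GRing.Theory Num.Theory.
Import numFieldNormedType.Exports.

Local Open Scope classical_set_scope.
Local Open Scope ring_scope.

Definition angle_sum (k : seq nat) : rat :=
  \sum_(x <- k) (x%:R - 2) / x%:R.

Definition unit_disc (R : realType) : set (R * R) :=
  [set p | p.1 ^+ 2 + p.2 ^+ 2 <= 1].
Arguments unit_disc R : clear implicits.

Definition circle_point (R : realType) (t : R) : R * R := (cos t, sin t).

(* A topological polygon is an embedded closed disc (the disc being compact, a
   continuous injection is a homeomorphism onto its image) whose boundary
   circle is cut into [psize] arcs at the angles [angle 0 < ... < angle psize],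
   where [angle psize] is [angle 0] after one full turn; in particular
   [0 < psize].  The values of [angle] beyond [psize] and those of [chart]
   outside the disc are irrelevant. *)
Record polygon (R : realType) := Polygon {
  psize : nat;
  chart : R * R -> R * R;
  angle : nat -> R;
  chart_continuous : {within unit_disc R, continuous chart};
  chart_inj : set_inj (unit_disc R) chart;
  angle_lt : forall i, (i < psize)%N -> angle i < angle i.+1;
  angle_turn : angle psize = angle 0%N + 2 * pi }.

HB.instance Definition _ (R : realType) := gen_eqMixin (polygon R).

Section Tilings.
Variable R : realType.
Implicit Types (P Q : polygon R) (T : set (polygon R)) (v : R * R).

Definition region P : set (R * R) := chart P @` unit_disc R.

Definition corners P : set (R * R) :=
  [set chart P (circle_point (angle P i)) | i in [set i | (i < psize P)%N]].

Definition side P (i : nat) : set (R * R) :=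
  [set chart P (circle_point t) | t in `[angle P i, angle P i.+1]].

Definition sides P : set (set (R * R)) :=
  [set side P i | i in [set i | (i < psize P)%N]].

Definition locally_finite T : Prop :=
  forall x : R * R, exists2 U, nbhs x U &
    finite_set [set P | T P /\ region P `&` U !=set0].

Definition edge_to_edge T : Prop :=
  forall P Q, T P -> T Q -> P <> Q ->
    [\/ region P `&` region Q = set0,
        exists2 v, corners P v /\ corners Q v &
          region P `&` region Q = [set v]
      | exists2 e, sides P e /\ sides Q e & region P `&` region Q = e].

(* Distinct tiles have disjoint interiors by [edge_to_edge], since sides are
   arcs; it also excludes two parametrizations of one and the same tile. *)
Definition tiling T : Prop :=
  [/\ \bigcup_(P in T) region P = setT, locally_finite T & edge_to_edge T].

Definition vertices T : set (R * R) := \bigcup_(P in T) corners P.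

Definition adjacent_at v P Q : bool :=
  `[< exists e, [/\ sides P e, sides Q e & e v] >].

(* [s] lists, in cyclic order around [v], the sizes of the tiles at [v]; it is
   thus determined up to rotation and reversal. *)
Definition vertex_type T v (s : seq nat) : Prop :=
  exists fs : seq (polygon R),
    [/\ uniq fs, forall P, P \in fs <-> T P /\ region P v,
        cycle (adjacent_at v) fs & s = [seq psize P | P <- fs]].

(* The unordered tuple is represented by any of its orderings [k]. *)
Definition pseudo_homogeneous_tiling T (k : seq nat) : Prop :=
  tiling T /\
  forall v, vertices T v -> exists2 s, vertex_type T v s & perm_eq s k.

End Tilings.

(* Main.v *)
Require Import Defs.
From HB Require Import structures.
From mathcomp Require Import all_boot all_order all_algebra.
From mathcomp Require Import all_classical all_reals all_analysis.
From mathcomp Require Import zify ring lra.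

Set Implicit Arguments.
Unset Strict Implicit.
Unset Printing Implicit Defensive.

Import Order.TTheory GRing.Theory Num.Theory.
Import numFieldNormedType.Exports.

Local Open Scope classical_set_scope.
Local Open Scope ring_scope.

(** The plane is cut into the strips [n <= y <= n + 1] and [- n - 1 <= y <= - n],
    and each strip into trapezoids and triangles with apex towards the axis
    [y = 0].  The two half-planes are built alike, in the direction away from the
    axis, which is called up.  Every tile is given extra corners on its top so
    as to have the size that is wanted: with [t] top sides, a trapezoid has
    [t + 3] sides and a triangle [t + 2], so sizes of at least 4 leave at least
    one top side to a trapezoid and two to a triangle.

    The row above is then forced up to the choice of sizes.  A vertex where two
    tops meet already belongs to two tiles and sends one edge upwards.  A vertex
    inside a top belongs to one tile only and sends out two edges, which bound a
    triangle between two trapezoids.  Thus all vertices have degree 4, over a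
    tile with [t] top sides there stand [t] trapezoids and [t - 1] triangles, and
    the first and the last of them are bounded by vertical lines.  The number of
    tiles in a row may grow exponentially, but since a row only subdivides the
    horizontal extent of the previous one, the tiling is locally finite.  The
    combinatorial data of such a construction are collected in [growth], and
    [growth_tiling] realizes them; tiles are polygons in the sense of the
    statement by radial projection of the disc ([radial_polygon],
    [trapezoid_exists]).

    It remains to choose sizes so that every vertex sees the four given ones.
    Along a lateral boundary, let [u i] and [w i] be the sizes of the tiles to the
    left and to the right in the i-th row.  The vertices on this path require that
    [u i], [w i], [u i.+1], [w i.+1] are the given sizes, so the pair on row [i]
    alternates between two complementary pairs, and only its order is free.  A
    state of a tile records its kind and the sequences chosen on both of its
    sides.  The obstructions come from few top sides: a trapezoid of size 4 has
    one, so the sequences on its two sides must continue with the same size; a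
    trapezoid of size 5 or a triangle of size 4 has two, and these need different
    sizes on top unless sizes are repeated.  In each of three cases, according to
    the number of sizes equal to 4, there is a finite set of states in which each
    tile has a row above it again ([two_squares_rule], [one_square_rule],
    [no_square_rule]).  That these sets are closed is a finite check, done by
    evaluation ([closed_rule]), because rows of large length are obtained by
    prolonging short ones. *)

(** * Radial homeomorphisms *)

Lemma continuous_pair (R : realType) (T : topologicalType) (a b : T -> R) x :
  {for x, continuous a} -> {for x, continuous b} ->
  {for x, continuous (fun y => (a y, b y))}.
Proof. by move=> ca cb; exact: (@cvg_pair _ _ _ _ (nbhs (a x)) (nbhs (b x))). Qed.

Section Gauge.
Variable R : realType.
Implicit Types (g h : R * R -> R) (p q : R * R).

(** The unit balls of gauges are the compact bodies that are star-shaped about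
    the origin in a continuous way; the bound says that the ball is bounded and
    that [g] vanishes only at the origin. *)
Record gauge g : Prop := Gauge {
  gauge_continuous : continuous g;
  gaugeZ : forall a p, 0 <= a -> g (a * p.1, a * p.2) = a * g p;
  gauge_bound : exists2 C, 0 < C &
    forall p, `|p.1| <= C * g p /\ `|p.2| <= C * g p }.

(** The dilation of each ray that turns [g] into [h]; it maps the unit ball of
    [g] onto that of [h], and is the chart of all tiles for [g] the Euclidean
    norm. *)
Definition rescale g h p : R * R := (g p / h p * p.1, g p / h p * p.2).

Lemma gauge0 g : gauge g -> g (0, 0) = 0.
Proof. by move=> gg; have := gaugeZ gg (0, 0) (lexx 0); rewrite /= !mul0r. Qed.

Lemma gauge_gt0 g p : gauge g -> p <> (0, 0) -> 0 < g p.
Proof.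
move=> [_ _ [C C0 /(_ p)[p1 p2]]] p0; rewrite -(pmulr_rgt0 _ C0) ltNge.
apply/negP => Cg; apply: p0; case: p p1 p2 Cg => x y /= x0 y0 C0'.
by congr pair; apply/eqP; rewrite -normr_le0 (le_trans _ C0').
Qed.

Lemma gauge_ge0 g p : gauge g -> 0 <= g p.
Proof.
move=> gg; have [->|/eqP p0] := eqVneq p (0, 0); first by rewrite gauge0.
exact/ltW/gauge_gt0.
Qed.

Lemma rescale0 g h : rescale g h (0, 0) = (0, 0).
Proof. by rewrite /rescale /= !mulr0. Qed.

Lemma gauge_rescale g h p : gauge g -> gauge h -> h (rescale g h p) = g p.
Proof.
move=> gg gh; have [->|/eqP p0] := eqVneq p (0, 0).
  by rewrite rescale0 !gauge0.
have hp := gauge_gt0 gh p0.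
rewrite /rescale gaugeZ ?divr_ge0 ?gauge_ge0// divfK//; exact: lt0r_neq0.
Qed.

Lemma rescaleK g h : gauge g -> gauge h -> cancel (rescale g h) (rescale h g).
Proof.
move=> gg gh p; have [->|/eqP p0] := eqVneq p (0, 0).
  by rewrite !rescale0.
have [gp hp] := (gauge_gt0 gg p0, gauge_gt0 gh p0).
rewrite {1}/rescale gauge_rescale// gaugeZ ?divr_ge0 ?ltW//=.
rewrite [RHS]surjective_pairing; congr pair.
  by field; rewrite !lt0r_neq0.
by field; rewrite !lt0r_neq0.
Qed.

(** Away from the origin this is a quotient of continuous functions, and at the
    origin the bound on [h] squeezes both coordinates by a multiple of [g]. *)
Lemma rescale_continuous g h : gauge g -> gauge h -> continuous (rescale g h).
Proof.
move=> gg gh p; have [->|/eqP p0] := eqVneq p (0, 0).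
  have [C C0 hC] := gauge_bound gh.
  have cv : (fun q => C * g q) @ nbhs ((0, 0) : R * R) --> (0 : R).
    have : (fun q => C * g q) @ nbhs ((0, 0) : R * R) --> C * g (0, 0).
      by apply: cvgM; [exact: cvg_cst|exact: gauge_continuous gg _].
    by rewrite gauge0// mulr0.
  have cvN : (fun q => - (C * g q)) @ nbhs ((0, 0) : R * R) --> (0 : R).
    by have := cvgN cv; rewrite oppr0; exact.
  have bound (f : R * R -> R) q : `|f q| <= C * h q ->
      - (C * g q) <= g q / h q * f q <= C * g q.
    move=> fq; rewrite -ler_norml normrM ger0_norm ?divr_ge0 ?gauge_ge0//.
    have [->|/eqP q0] := eqVneq q (0, 0); first by rewrite gauge0// !mul0r mulr0.
    have hq := gauge_gt0 gh q0; rewrite mulrAC ler_pdivrMr// mulrC.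
    by rewrite mulrAC ler_wpM2r ?gauge_ge0.
  rewrite /continuous_at rescale0.
  apply: (@cvg_pair _ _ _ _ (nbhs (0 : R)) (nbhs (0 : R))) => /=.
    apply: (@squeeze_cvgr _ _ _ _ (fun q => - (C * g q)) (fun q => C * g q)) => //.
    by near=> q; apply: (bound fst); case: (hC q).
  apply: (@squeeze_cvgr _ _ _ _ (fun q => - (C * g q)) (fun q => C * g q)) => //.
  by near=> q; apply: (bound snd); case: (hC q).
have quot : (fun q => g q / h q) @ p --> g p / h p.
  apply: cvgM; first exact: gauge_continuous gg _.
  apply: cvgV; last exact: gauge_continuous gh _.
  exact/lt0r_neq0/gauge_gt0.
apply: (@continuous_pair _ _ (fun q => g q / h q * q.1)
  (fun q => g q / h q * q.2)); apply: cvgM => //; [exact: cvg_fst|exact: cvg_snd].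
Unshelve. all: by end_near.
Qed.

Definition euclid p : R := Num.sqrt (p.1 ^+ 2 + p.2 ^+ 2).

Lemma euclid_gauge : gauge euclid.
Proof.
split.
- move=> p; apply: continuous_comp; last exact: sqrt_continuous.
  by apply: cvgD; rewrite /continuous_at; under eq_fun do rewrite expr2;
    rewrite expr2; apply: cvgM; (exact: cvg_fst || exact: cvg_snd).
- move=> a p a0; rewrite /euclid /= !exprMn -mulrDr sqrtrM ?sqr_ge0//.
  by rewrite sqrtr_sqr ger0_norm.
- exists 1 => // p; rewrite !mul1r /euclid.
  by rewrite -!sqrtr_sqr; split; apply: ler_wsqrtr; rewrite (lerDl, lerDr) sqr_ge0.
Qed.

Lemma unit_discE p : unit_disc R p <-> euclid p <= 1.
Proof.
rewrite /unit_disc /euclid /=; rewrite -[in X in _ <-> X]sqrtr1.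
by rewrite ler_sqrt ?ltr01.
Qed.

Lemma euclid_circle t : euclid (circle_point t) = 1 :> R.
Proof. by rewrite /euclid /circle_point /= cos2Dsin2 sqrtr1. Qed.
End Gauge.

(** * Boundary arcs that are segments *)

Section RadialPolygon.
Variable R : realType.
Implicit Types (g : R * R -> R) (A B p q : R * R).

Definition lerp (a b s : R) : R := (1 - s) * a + s * b.

Definition segment A B : set (R * R) :=
  [set (lerp A.1 B.1 s, lerp A.2 B.2 s) | s in `[0, 1]].

Lemma segmentP A B q : segment A B q <->
  exists2 s, 0 <= s <= 1 & q = (lerp A.1 B.1 s, lerp A.2 B.2 s).
Proof.
by split=> [[s sI <-]|[s sI ->]]; exists s => //; move: sI; rewrite /= in_itv.
Qed.

Lemma rescale_ray g t k q : gauge g -> g q = 1 -> 0 < k ->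
  q = (k * cos t, k * sin t) -> rescale (@euclid R) g (circle_point t) = q.
Proof.
move=> gg gq k0 qE; have := gaugeZ gg (circle_point t) (ltW k0).
rewrite /rescale euclid_circle -qE gq => /esym kg.
have -> : 1 / g (circle_point t) = k.
  have gk : k != 0 by rewrite lt0r_neq0.
  by rewrite -[g _](mulKf gk) kg mulr1 invrK mul1r.
by rewrite qE.
Qed.

Lemma sin_ge0_subr (a b : R) : a <= b -> b <= a + pi -> 0 <= sin (b - a).
Proof. by move=> ab ba; apply: sin_ge0_pi; rewrite subr_ge0 ab lerBlDl. Qed.

Lemma arc_combination (al be t : R) :
  sin (be - al) * cos t = sin (be - t) * cos al + sin (t - al) * cos be /\
  sin (be - al) * sin t = sin (be - t) * sin al + sin (t - al) * sin be.
Proof. by rewrite !sinB; split; ring. Qed.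

(** The directions between [al] and [be] are the nonnegative combinations of the
    two extreme ones, as [be - al < pi]; so the segment and the arc sweep the
    same rays, and both meet each ray where [g] equals 1.  The direction of a
    given point [q] of the segment is found by the intermediate value theorem,
    as a zero of the cross product of [q] with the moving direction. *)
Lemma arc_segment g A B (al be a b : R) : gauge g -> al < be -> be < al + pi ->
  0 < a -> 0 < b -> A = (a * cos al, a * sin al) -> B = (b * cos be, b * sin be) ->
  (forall q, segment A B q -> g q = 1) ->
  [set rescale (@euclid R) g (circle_point t) | t in `[al, be]] = segment A B.
Proof.
move=> gg albe beal a0 b0 AE BE g1.
have d0 : 0 < sin (be - al).
  by apply: sin_gt0_pi; rewrite subr_gt0 albe ltrBlDl.
apply/seteqP; split=> [_ [t tI <-]|q sq].
  have /andP[alt tbe] : al <= t <= be by move: tI; rewrite /= in_itv.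
  have := sin_ge0_subr alt; have := sin_ge0_subr tbe.
  have [] := arc_combination al be t.
  move: (sin (t - al)) (sin (be - t)) => W U cE sE /(_ ltac:(lra)) U0 /(_ ltac:(lra)) W0.
  (* The weights cannot vanish together, since the direction of [t] is not 0. *)
  have [D0|D0] := ltP 0 (b * U + a * W); last first.
    have [bU aW] : 0 <= b * U /\ 0 <= a * W by rewrite !mulr_ge0// ltW.
    have UE : U = 0 by apply: (mulfI (lt0r_neq0 b0)); rewrite mulr0; lra.
    have WE : W = 0 by apply: (mulfI (lt0r_neq0 a0)); rewrite mulr0; lra.
    have : (sin (be - al)) ^+ 2 * (cos t ^+ 2 + sin t ^+ 2) = 0.
      by rewrite mulrDr -!exprMn cE sE UE WE !mul0r !addr0 expr0n/= addr0.
    by rewrite cos2Dsin2 mulr1 => /eqP; rewrite sqrf_eq0 gt_eqF.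
  have Dn : b * U + a * W != 0 by rewrite lt0r_neq0.
  have sP : segment A B (lerp A.1 B.1 (a * W / (b * U + a * W)),
                         lerp A.2 B.2 (a * W / (b * U + a * W))).
    apply/segmentP; exists (a * W / (b * U + a * W)) => //.
    by rewrite divr_ge0 ?mulr_ge0 ?ler_pdivrMr// ?mul1r ?lerDr ?mulr_ge0// ltW.
  rewrite (@rescale_ray _ _ (a * b * sin (be - al) / (b * U + a * W)) _ gg (g1 _ sP))//.
    by rewrite divr_gt0// !mulr_gt0.
  rewrite AE BE /lerp /=; congr pair.
    transitivity (a * b * (sin (be - al) * cos t) / (b * U + a * W)); last by ring.
    by rewrite cE; field.
  transitivity (a * b * (sin (be - al) * sin t) / (b * U + a * W)); last by ring.
  by rewrite sE; field.
have [s /andP[s0 s1] /esym qE] := (segmentP A B q).1 sq.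
pose F t := q.1 * sin t - q.2 * cos t.
have FE t : F t = (1 - s) * a * sin (t - al) - s * b * sin (be - t).
  by rewrite /F -qE /lerp AE BE !sinB /=; ring.
have Fal : F al <= 0.
  by rewrite FE subrr sin0 mulr0 sub0r oppr_le0 !mulr_ge0// ltW.
have Fbe : 0 <= F be.
  by rewrite FE subrr sin0 mulr0 subr0 !mulr_ge0 ?subr_ge0// ltW.
have Fc : continuous F.
  move=> t; apply: cvgB; apply: cvgM; try exact: cvg_cst.
    exact: continuous_sin.
  exact: continuous_cos.
have [|t] := IVT (v := 0) (ltW albe) (continuous_subspaceT Fc).
  by rewrite ge_min Fal le_max Fbe orbT.
rewrite in_itv/= => /andP[alt tbe] Ft.
have U0 := sin_ge0_subr tbe ltac:(lra); have W0 := sin_ge0_subr alt ltac:(lra).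
pose k := q.1 * cos t + q.2 * sin t.
have q1 : q.1 = k * cos t.
  transitivity (q.1 * (cos t ^+ 2 + sin t ^+ 2) - sin t * F t).
    by rewrite Ft cos2Dsin2; ring.
  by rewrite /k /F; ring.
have q2 : q.2 = k * sin t.
  transitivity (q.2 * (cos t ^+ 2 + sin t ^+ 2) + cos t * F t).
    by rewrite Ft cos2Dsin2; ring.
  by rewrite /k /F; ring.
have kW : k * sin (t - al) = s * b * sin (be - al).
  transitivity (cos al * q.2 - sin al * q.1); first by rewrite q1 q2 sinB; ring.
  by rewrite -qE AE BE /lerp /= sinB; ring.
have kU : k * sin (be - t) = (1 - s) * a * sin (be - al).
  transitivity (q.1 * sin be - q.2 * cos be); first by rewrite q1 q2 sinB; ring.
  by rewrite -qE AE BE /lerp /= sinB; ring.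
have k0 : 0 < k.
  have pos : 0 < k * (sin (t - al) + sin (be - t)).
    rewrite mulrDr kW kU -mulrDl mulr_gt0//.
    have [->|sn] := eqVneq s 0; first by rewrite mul0r add0r subr0 mul1r.
    by rewrite ltr_wpDr ?mulr_ge0 ?subr_ge0// ?ltW// mulr_gt0// lt_neqAle eq_sym sn.
  rewrite ltNge; apply/negP => kle; move: pos; rewrite ltNge => /negP; apply.
  by rewrite mulr_le0_ge0// addr_ge0.
exists t; first by rewrite /= in_itv/= alt tbe.
by apply: (@rescale_ray _ _ k) => //; [exact: g1|rewrite -q1 -q2 -surjective_pairing].
Qed.
End RadialPolygon.

(** * Trapezoids as polygons *)

Section Trapezoid.
Variable R : realType.
Implicit Types (g : R * R -> R) (A B p q : R * R).

Lemma segmentC A B : segment A B = segment B A.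
Proof.
suff sub A' B' : segment A' B' `<=` segment B' A' by apply/seteqP; split; exact: sub.
move=> q /segmentP[s s01 ->]; apply/segmentP; exists (1 - s); first lra.
by rewrite /lerp; congr pair; ring.
Qed.

Lemma segment_left A B : segment A B A.
Proof.
apply/segmentP; exists 0; first by rewrite lexx ler01.
by rewrite /lerp [LHS]surjective_pairing; congr pair; ring.
Qed.

Lemma segment_right A B : segment A B B.
Proof. by rewrite segmentC; exact: segment_left. Qed.

Definition affine (Phi : R * R -> R * R) := forall A B s,
  Phi (lerp A.1 B.1 s, lerp A.2 B.2 s) =
  (lerp (Phi A).1 (Phi B).1 s, lerp (Phi A).2 (Phi B).2 s).

Lemma affine_segment Phi A B : affine Phi ->
  Phi @` segment A B = segment (Phi A) (Phi B).
Proof.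
move=> aff; apply/seteqP; split=> [_ [q /segmentP[s s01 ->] <-]|q /segmentP[s s01 ->]].
  by apply/segmentP; exists s.
by rewrite -aff; exists (lerp A.1 B.1 s, lerp A.2 B.2 s) => //; apply/segmentP; exists s.
Qed.

(** A star-shaped body with finitely many straight sides is a polygon, and so is
    its image under a homeomorphism [Phi] that preserves segments.  The corner
    [A i] is at distance [rho i] in the direction [th i]. *)
Lemma radial_polygon g (Phi : R * R -> R * R) n (A : nat -> R * R) (th rho : nat -> R) :
  gauge g -> continuous Phi -> injective Phi -> affine Phi ->
  (forall i, (i <= n)%N -> 0 < rho i /\ A i = (rho i * cos (th i), rho i * sin (th i))) ->
  (forall i, (i < n)%N -> th i < th i.+1 < th i + pi) -> th n = th 0%N + 2 * pi ->
  (forall i q, (i < n)%N -> segment (A i) (A i.+1) q -> g q = 1) ->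
  exists P : polygon R, [/\ psize P = n, region P = Phi @` [set q | g q <= 1],
    corners P = [set Phi (A i) | i in [set i | (i < n)%N]] &
    forall i, (i < n)%N -> sides P (segment (Phi (A i)) (Phi (A i.+1)))].
Proof.
move=> gg cPhi iPhi aPhi Ath thlt thn g1.
pose f := Phi \o rescale (@euclid R) g.
have cf : {within unit_disc R, continuous f}.
  apply: continuous_subspaceT => p; apply: continuous_comp; last exact: cPhi.
  exact: rescale_continuous (euclid_gauge R) gg p.
have injf : set_inj (unit_disc R) f.
  move=> p q _ _ /iPhi; exact: (can_inj (rescaleK (euclid_gauge R) gg)).
have incr i : (i < n)%N -> th i < th i.+1 by move=> /thlt/andP[].
exists (Polygon cf injf incr thn); split => //=.
- rewrite /region/=; apply/seteqP; split=> [_ [p /unit_discE p1 <-]|_ [q q1 <-]].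
    by exists (rescale (@euclid R) g p) => //=; rewrite gauge_rescale//; exact: euclid_gauge.
  exists (rescale g (@euclid R) q); last by rewrite /f/= rescaleK//; exact: euclid_gauge.
  by apply/unit_discE; rewrite gauge_rescale//; exact: euclid_gauge.
- rewrite /corners/=; apply: eq_imagel => i /= lti; rewrite /f/=; congr Phi.
  have [r0 Ai] := Ath i (ltnW lti).
  by apply: rescale_ray r0 Ai => //; apply: (g1 _ _ lti); exact: segment_left.
- move=> i lti; exists i => //; rewrite /side/= -affine_segment//.
  have [[r0 Ai] [r1 Ai1]] := (Ath i (ltnW lti), Ath i.+1 lti).
  have /andP[lt1 lt2] := thlt i lti.
  rewrite -(arc_segment gg lt1 lt2 r0 r1 Ai Ai1); last by move=> q; exact: g1.
  by rewrite image_comp.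
Qed.

(** Its unit ball is the symmetric trapezoid of height 2 whose half-width at
    level [y] is [rho + be * y]. *)
Definition trapezoid_gauge (rho be : R) p := Num.max `|p.2| ((`|p.1| - be * p.2) / rho).

Lemma trapezoid_gaugeP rho be : 0 < rho -> gauge (trapezoid_gauge rho be).
Proof.
move=> rho0; split.
- move=> p; apply: (@continuous_max _ _ (fun p => `|p.2|)
    (fun p => (`|p.1| - be * p.2) / rho)).
    by apply: cvg_norm; exact: cvg_snd.
  apply: cvgM; last exact: cvg_cst.
  apply: cvgB; first by apply: cvg_norm; exact: cvg_fst.
  by apply: cvgM; [exact: cvg_cst|exact: cvg_snd].
- move=> a p a0; rewrite /trapezoid_gauge /= !normrM ger0_norm// maxr_pMr//.
  by congr Num.max; ring.
- exists (1 + rho + `|be|); first by rewrite ltr_pwDl ?normr_ge0// addr_gt0.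
  move=> p; set g := trapezoid_gauge _ _ _.
  have g2 : `|p.2| <= g by rewrite le_max lexx.
  have : (`|p.1| - be * p.2) / rho <= g by rewrite le_max lexx orbT.
  rewrite ler_pdivrMr// => g1; have g0 : 0 <= g := le_trans (normr_ge0 _) g2.
  have : be * p.2 <= `|be| * g.
    by rewrite (le_trans (ler_norm _))// normrM ler_wpM2l.
  have : 0 <= `|be| * g by rewrite mulr_ge0.
  have : 0 <= rho * g by rewrite mulr_ge0// ltW.
  move: (`|be|) => b' *; split; lra.
Qed.

Lemma trapezoid_gauge_le1 rho be p : 0 < rho ->
  (trapezoid_gauge rho be p <= 1) = (`|p.2| <= 1) && (`|p.1| <= rho + be * p.2).
Proof.
by move=> rho0; rewrite /trapezoid_gauge ge_max ler_pdivrMr// mul1r lerBlDr.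
Qed.

Lemma trapezoid_gauge_eq1 rho be p : 0 < rho ->
  `|p.2| <= 1 -> `|p.1| <= rho + be * p.2 ->
  `|p.2| = 1 \/ `|p.1| = rho + be * p.2 -> trapezoid_gauge rho be p = 1.
Proof.
move=> rho0 p2 p1 bd; apply/eqP; rewrite eq_le trapezoid_gauge_le1// p2 p1/=.
rewrite /trapezoid_gauge le_max; case: bd => ->; first by rewrite lexx.
by rewrite addrK divff ?lexx ?orbT// lt0r_neq0.
Qed.

Lemma sin_atan (u : R) : sin (atan u) = u * cos (atan u).
Proof.
have c0 : cos (atan u) != 0.
  by rewrite lt0r_neq0// cos_gt0_pihalf// atan_gtNpi2 atan_ltpi2.
by rewrite -[u in u * _]atanK /tan divfK.
Qed.

Lemma cos_atan_gt0 (u : R) : 0 < cos (atan u).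
Proof. by rewrite cos_gt0_pihalf// atan_gtNpi2 atan_ltpi2. Qed.

Lemma direction_down (u : R) : (u, -1) = ((cos (atan u))^-1 * cos (atan u - pi / 2),
  (cos (atan u))^-1 * sin (atan u - pi / 2)).
Proof.
rewrite cosBpihalf sinBpihalf sin_atan; have := lt0r_neq0 (cos_atan_gt0 u).
by move=> c; congr pair; field.
Qed.

Lemma direction_up (u : R) : (u, 1) = ((cos (atan u))^-1 * cos (pi / 2 - atan u),
  (cos (atan u))^-1 * sin (pi / 2 - atan u)).
Proof.
rewrite -opprB cosN sinN cosBpihalf sinBpihalf sin_atan.
by have := lt0r_neq0 (cos_atan_gt0 u); move=> c; congr pair; field.
Qed.

Definition subdiv (a b : R) (n i : nat) : R := lerp a b (i%:R / n%:R).

Lemma subdiv_lt (a b : R) n i j : a < b -> (0 < n)%N -> (i < j)%N ->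
  subdiv a b n i < subdiv a b n j.
Proof.
move=> ab n0 ij; rewrite /subdiv /lerp.
have : i%:R / n%:R < j%:R / n%:R :> R.
  by rewrite ltr_pM2r ?ltr_nat// invr_gt0 ltr0n.
by move: (_ / _) (_ / _) => x y; nra.
Qed.

Lemma subdiv0 (a b : R) n : subdiv a b n 0 = a.
Proof. by rewrite /subdiv /lerp mul0r; ring. Qed.

Lemma subdivn (a b : R) n : (0 < n)%N -> subdiv a b n n = b.
Proof. by move=> n0; rewrite /subdiv /lerp divff ?pnatr_eq0 -?lt0n//; ring. Qed.

Section Corners.
Variables (wb wt : R) (t : nat).
Hypotheses (wb0 : 0 <= wb) (wt0 : 0 < wt) (t0 : (0 < t)%N).

(** The corners of the symmetric trapezoid with half-widths [wb] at the bottom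
    and [wt] at the top, counterclockwise from the bottom left one, which is
    listed a second time at the end.  The first two coincide when [wb] is 0, and
    then the count starts with the second. *)
Definition corner_x i : R := match i with
  | 0 => - wb | 1 => wb | j.+2 => if (j <= t)%N then subdiv (- wt) wt t (t - j) else - wb end.

Definition corner_y i : R := if (1 < i <= t.+2)%N then 1 else -1.

(** The arctangent gives the angle with the vertical axis, so that one formula
    covers a whole horizontal side. *)
Definition corner_angle i : R :=
  if (i <= 1)%N then atan (corner_x i) - pi / 2 else
  if (i <= t.+2)%N then pi / 2 - atan (corner_x i) else
  atan (corner_x i) - pi / 2 + pi *+ 2.

Lemma corner_direction i : (corner_x i, corner_y i) =
  ((cos (atan (corner_x i)))^-1 * cos (corner_angle i),
   (cos (atan (corner_x i)))^-1 * sin (corner_angle i)).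
Proof.
rewrite /corner_angle /corner_y; case: leqP => i1 /=; first exact: direction_down.
case: leqP => it; first exact: direction_up.
rewrite cosD2pi sinD2pi; exact: direction_down.
Qed.

Lemma atan_gt0 (u : R) : 0 < u -> 0 < atan u.
Proof. by move=> u0; rewrite -(@atan0 R) lt_atan. Qed.

(** Two consecutive corners span an angle less than [pi]: on a horizontal side
    because arctangents differ by less than [pi], on a lateral side because
    [atan wb + atan wt] is positive. *)
Lemma corner_angle_lt i : (0 < wb) || (0 < i)%N -> (i < t.+3)%N ->
  corner_angle i < corner_angle i.+1 < corner_angle i + pi.
Proof.
have pi0 := @pi_gt0 R.
have bd (u : R) := (atan_gtNpi2 u, atan_ltpi2 u).
have [wtb wbb] := (bd wt, bd wb).
have wta := atan_gt0 wt0.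
have wba : 0 <= atan wb by rewrite -(@atan0 R) le_atan.
case: i => [|[|i]]; rewrite /= ?orbF ?orbT.
- move=> wb1 _; rewrite /corner_angle/= atanN; have := atan_gt0 wb1.
  move: wtb wbb => [? ?] [? ?] ?; apply/andP; split; lra.
- move=> _ _; rewrite /corner_angle/= subn0 subdivn//.
  move: wtb wbb => [? ?] [? ?]; apply/andP; split; lra.
- rewrite 3!ltnS => _ it; rewrite /corner_angle/= it !ltnS.
  have [<-|it'] := eqVneq i t.
    rewrite ltnn leqnn subnn subdiv0 !atanN -mulr_natl.
    move: wtb wbb => [? ?] [? ?]; apply/andP; split; lra.
  have {}it : (i < t)%N by rewrite ltn_neqAle it'.
  rewrite it (ltnW it).
  have lt1 : subdiv (- wt) wt t (t - i.+1) < subdiv (- wt) wt t (t - i).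
    by apply: subdiv_lt => //; [rewrite (lt_trans _ wt0) ?oppr_lt0|lia].
  have := lt_atan lt1; have := bd (subdiv (- wt) wt t (t - i.+1)).
  have := bd (subdiv (- wt) wt t (t - i)).
  by move=> [? ?] [? ?] ?; apply/andP; split; lra.
Qed.

Lemma corner_angle_turn (o : nat) : o = (wb == 0) ->
  corner_angle t.+3 = corner_angle o + 2 * pi.
Proof.
move=> ->; rewrite /corner_angle/= !ltnS !ltnn mulr_natl.
by have [wbE|_] := eqVneq wb 0; rewrite //= wbE oppr0.
Qed.

Definition half_width (y : R) := (wb + wt) / 2 + (wt - wb) / 2 * y.

(** All sides lie on the boundary of the unit ball of [trapezoid_gauge]: either
    the height or the width is extremal. *)
Lemma corner_side i q : (0 < wb) || (0 < i)%N -> (i < t.+3)%N ->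
  segment (corner_x i, corner_y i) (corner_x i.+1, corner_y i.+1) q ->
  [/\ `|q.2| <= 1, `|q.1| <= half_width q.2 &
      `|q.2| = 1 \/ `|q.1| = half_width q.2].
Proof.
move=> i0 it /segmentP[s /andP[s0 s1] ->] /=; rewrite /lerp /half_width.
case: i i0 it => [|[|i]]; rewrite /corner_y /= ?orbF ?orbT.
- move=> wb1 _; have -> : (1 - s) * -1 + s * -1 = -1 by ring.
  rewrite normrN1; split => //; last by left.
  by rewrite ler_norml; apply/andP; split; nra.
- move=> _ _; rewrite subn0 subdivn//.
  have e : (1 - s) * wb + s * wt = (wb + wt) / 2 + (wt - wb) / 2 * ((1 - s) * -1 + s * 1).
    by field.
  have e0 : 0 <= (1 - s) * wb + s * wt.
    by rewrite addr_ge0 ?mulr_ge0 ?subr_ge0// ltW.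
  rewrite (ger0_norm e0) -e; split; [|by []|by right].
  by rewrite ler_norml; apply/andP; split; lra.
- rewrite 3!ltnS => _ it; rewrite it !ltnS.
  have [<-|it'] := eqVneq i t.
    rewrite ltnn subnn subdiv0.
    have e : (1 - s) * - wt + s * - wb =
      - ((wb + wt) / 2 + (wt - wb) / 2 * ((1 - s) * 1 + s * -1)) by field.
    have e0 : (1 - s) * - wt + s * - wb <= 0.
      by rewrite !mulrN -opprD oppr_le0 addr_ge0 ?mulr_ge0 ?subr_ge0// ltW.
    rewrite (ler0_norm e0) e opprK; split; [|by []|by right].
    by rewrite ler_norml; apply/andP; split; lra.
  have {}it : (i < t)%N by rewrite ltn_neqAle it'.
  rewrite it; have -> : (1 - s) * 1 + s * 1 = 1 :> R by ring.
  rewrite normr1; split => //; last by left.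
  have bd j : (j <= t)%N -> - wt <= subdiv (- wt) wt t j <= wt.
    move=> jt; rewrite /subdiv /lerp.
    have : 0 <= (j%:R / t%:R : R) <= 1.
      by rewrite divr_ge0//= ler_pdivrMr ?ltr0n// mul1r ler_nat.
    move: (_ / _) => x /andP[x0 x1].
    have := mulr_ge0 x0 (ltW wt0).
    have := mulr_ge0 (etrans (subr_ge0 _ _) x1) (ltW wt0).
    by move=> ? ?; apply/andP; split; lra.
  have /andP[? ?] := bd (t - i)%N ltac:(lia).
  have /andP[? ?] := bd (t - i.+1)%N ltac:(lia).
  by rewrite ler_norml; apply/andP; split; nra.
Qed.
End Corners.
End Trapezoid.

Section TrapezoidPolygon.
Variable R : realType.
Implicit Types (p q v : R * R).

(** The tile with bottom [[bl, br]] at height [h] and top [[lo, hi]] at height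
    [h + 1], mirrored in the horizontal axis when [sg] is -1; its top is divided
    into [t] equal sides.  It is a triangle when [bl = br]. *)
Record is_trapezoid (sg h bl br lo hi : R) (t : nat) (P : polygon R) : Prop := IsTrapezoid {
  trapezoid_size : psize P = (t + 2 + (bl < br)%R)%N;
  trapezoid_region : forall p, region P p <-> exists s, [/\ 0 <= s <= 1,
    p.2 = sg * (h + s) & lerp bl lo s <= p.1 <= lerp br hi s];
  trapezoid_corners : forall v, corners P v <->
    [\/ v = (bl, sg * h), v = (br, sg * h) |
        exists2 i, (i <= t)%N & v = (subdiv lo hi t i, sg * (h + 1))];
  trapezoid_bottom : bl < br -> sides P (segment (bl, sg * h) (br, sg * h));
  trapezoid_top : forall i, (i < t)%N -> sides P
    (segment (subdiv lo hi t i, sg * (h + 1)) (subdiv lo hi t i.+1, sg * (h + 1)));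
  trapezoid_left : sides P (segment (bl, sg * h) (lo, sg * (h + 1)));
  trapezoid_right : sides P (segment (br, sg * h) (hi, sg * (h + 1))) }.

Section Construction.
Variables (sg h bl br lo hi : R) (t : nat).
Hypotheses (sg0 : sg != 0) (blbr : bl <= br) (lohi : lo < hi) (t0 : (0 < t)%N).

Let wb := (br - bl) / 2.
Let wt := (hi - lo) / 2.

(** A shear makes the lateral sides symmetric about the vertical axis, as
    required by [trapezoid_gauge]. *)
Definition strip_map q : R * R :=
  (lerp ((bl + br) / 2) ((lo + hi) / 2) ((1 + q.2) / 2) + q.1,
   sg * (h + (1 + q.2) / 2)).

Lemma strip_map_continuous : continuous strip_map.
Proof.
have half : continuous (fun q : R * R => (1 + q.2) / 2).
  move=> q; apply: cvgM; last exact: cvg_cst.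
  by apply: cvgD; [exact: cvg_cst|exact: cvg_snd].
move=> q; apply: (@continuous_pair _ _
  (fun q => lerp ((bl + br) / 2) ((lo + hi) / 2) ((1 + q.2) / 2) + q.1)
  (fun q => sg * (h + (1 + q.2) / 2))).
  apply: cvgD; last exact: cvg_fst.
  apply: cvgD; apply: cvgM; try exact: cvg_cst; last exact: half.
  by apply: cvgB; [exact: cvg_cst|exact: half].
by apply: cvgM; [exact: cvg_cst|apply: cvgD; [exact: cvg_cst|exact: half]].
Qed.

Lemma strip_map_inj : injective strip_map.
Proof.
move=> [x y] [x' y'] [] /= ex /(mulfI sg0) ey.
have yE : y = y' by lra.
by move: ex; rewrite yE => /addrI ->.
Qed.

Lemma strip_map_affine : affine strip_map.
Proof. by move=> A B s; rewrite /strip_map /lerp /=; congr pair; field. Qed.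

Let C i := strip_map (corner_x wb wt t i, corner_y R t i).

Lemma strip_corner0 : C 0 = (bl, sg * h).
Proof. by rewrite /C /strip_map /corner_y /lerp /wb /=; congr pair; field. Qed.

Lemma strip_corner1 : C 1 = (br, sg * h).
Proof. by rewrite /C /strip_map /corner_y /lerp /wb /=; congr pair; field. Qed.

Lemma strip_corner2 i : (i <= t)%N ->
  C i.+2 = (subdiv lo hi t (t - i), sg * (h + 1)).
Proof.
move=> it; rewrite /C /strip_map /= it /corner_y !ltnS it /=.
rewrite /subdiv /lerp /wt; move: (_ / t%:R) => x.
by congr pair; field.
Qed.

Lemma strip_corner_last : C t.+3 = (bl, sg * h).
Proof.
rewrite -strip_corner0 /C /=; congr (strip_map (_, _)); first by rewrite ltnn.
by rewrite /corner_y ltnn andbF.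
Qed.

Lemma trapezoid_exists : exists P, is_trapezoid sg h bl br lo hi t P.
Proof.
have wb0 : 0 <= wb by rewrite /wb divr_ge0 ?subr_ge0.
have wt0 : 0 < wt by rewrite /wt divr_gt0 ?subr_gt0.
(* For a triangle the corners are counted from the second one on. *)
pose o : nat := wb == 0.
have oP i : (0 < wb) || (0 < i + o)%N.
  by rewrite /o lt_neqAle wb0 andbT eq_sym; case: eqP => //= _; rewrite addn1.
have o1 : (o <= 1)%N by rewrite /o; case: eqP.
have oE : (t.+3 - o)%N = (t + 2 + (bl < br)%R)%N.
  have -> : (bl < br) = (wb != 0).
    by rewrite /wb mulf_eq0 invr_eq0 pnatr_eq0 orbF subr_eq0 eq_sym lt_neqAle blbr andbT.
  by rewrite /o; case: eqP => /= _; lia.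
pose rho := (wb + wt) / 2; pose be := (wt - wb) / 2.
have rho0 : 0 < rho by rewrite /rho divr_gt0// ltr_wpDl.
have [||||P [Psize Pregion Pcorners Psides]] := @radial_polygon R
    (trapezoid_gauge rho be) strip_map (t.+3 - o)
    (fun i => (corner_x wb wt t (i + o), corner_y R t (i + o)))
    (fun i => corner_angle wb wt t (i + o))
    (fun i => (cos (atan (corner_x wb wt t (i + o))))^-1)
    (trapezoid_gaugeP be rho0) strip_map_continuous strip_map_inj strip_map_affine.
- move=> i _; split; first by rewrite invr_gt0 cos_atan_gt0.
  exact: corner_direction.
- by move=> i iN; rewrite addSn; apply: corner_angle_lt => //; lia.
- by rewrite subnK ?add0n; [exact: corner_angle_turn|lia].
- move=> i q iN; rewrite addSn => sq.
  have [] := corner_side wb0 wt0 t0 (oP i) ltac:(lia) sq.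
  exact: trapezoid_gauge_eq1.
have side i : (o <= i < t.+3)%N -> sides P (segment (C i) (C i.+1)).
  by move=> /andP[oi it]; have := Psides (i - o)%N ltac:(lia); rewrite addSn subnK.
have cornerP v : corners P v <-> exists2 i, (o <= i < t.+3)%N & v = C i.
  rewrite Pcorners; split=> [[i /= iN <-]|[i /andP[oi it] ->]].
    by exists (i + o)%N => //; lia.
  by exists (i - o)%N; [rewrite /=; lia|rewrite subnK].
have blE : o = 1%N -> bl = br.
  by rewrite /o /wb; case: eqP => // e _; lra.
exists P; split.
- by rewrite Psize oE.
- move=> p; rewrite Pregion; split.
    move=> [[x y] /=]; rewrite trapezoid_gauge_le1//= !ler_norml => /andP[/andP[y1 y2] /andP[x1 x2]] <-.
    exists ((1 + y) / 2); split => //=; first by apply/andP; split; lra.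
    move: x1 x2; rewrite /lerp /rho /be /wb /wt => x1 x2.
    by apply/andP; split; lra.
  case: p => x y [s /= [/andP[s0 s1] -> /andP[x1 x2]]].
  exists (x - lerp ((bl + br) / 2) ((lo + hi) / 2) s, 2 * s - 1).
    rewrite /= trapezoid_gauge_le1//= !ler_norml.
    move: x1 x2; rewrite /lerp /rho /be /wb /wt => x1 x2.
    by apply/andP; split; apply/andP; split; lra.
  rewrite /strip_map /=; have -> : (1 + (2 * s - 1)) / 2 = s by field.
  by congr pair; ring.
- move=> v; rewrite cornerP; split.
    move=> [[|[|i]] /andP[oi it] ->]; rewrite ?strip_corner0 ?strip_corner1.
    + exact: Or31.
    + exact: Or32.
    + rewrite strip_corner2; last by lia.
      by apply: Or33; exists (t - i)%N => //; lia.
  case=> [->|->|[i it ->]].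
  + have [/blE -> |on] := eqVneq o 1%N; first by exists 1%N; rewrite ?strip_corner1//; lia.
    by exists 0%N; rewrite ?strip_corner0//; lia.
  + by exists 1%N; rewrite ?strip_corner1//; lia.
  + have it' : (t - i <= t)%N by exact: leq_subr.
    exists (t - i).+2; first by clear -o1 it'; lia.
    by rewrite strip_corner2// subKn.
- move=> lt; rewrite -strip_corner0 -strip_corner1; apply: side; rewrite andbT.
  by rewrite /o /wb; case: eqP => // e; lra.
- move=> i it; rewrite segmentC.
  have := side (t - i.+1).+2 ltac:(clear -o1 it; lia); rewrite !strip_corner2; [|lia..].
  by rewrite -!subSn ?subSS ?subKn//; lia.
- rewrite segmentC -strip_corner_last.
  have := side t.+2 ltac:(clear -o1; lia); by rewrite [C t.+2]strip_corner2// subnn subdiv0.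
- have := side 1%N ltac:(clear -o1; lia).
  by rewrite strip_corner1 strip_corner2// subn0 subdivn.
Qed.
End Construction.
End TrapezoidPolygon.

(** * Combinatorics and coordinates of the strips *)

(** The combinatorial input of the construction.  Each tile has a state, which
    fixes its number of sides, whether it is a triangle (its bottom is the
    [apex]), and the states of the tiles [above] it.  The latter alternate
    between trapezoids, which stand on the top sides of the tile, and triangles,
    which stand on the inner vertices of its top; hence their number is odd and
    the number of top sides is [uphalf] of it.  The relation [adj] holds between
    horizontal neighbours, and [base] lists the lowest row of either half-plane.
    The axioms [above_vertex], [adj_vertex] and [base_vertex] prescribe the
    sizes around the three kinds of vertices: inner vertices of a top, vertices
    where two tops meet, and vertices of the axis. *)
Record growth (k : seq nat) := Growth {
  face : Type;
  fsize : face -> nat;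
  apex : face -> bool;
  above : face -> seq face;
  adj : face -> face -> Prop;
  above_odd : forall x, odd (size (above x));
  fsizeE : forall x, fsize x = (uphalf (size (above x)) + 2 + ~~ apex x)%N;
  above_apex : forall x i, (i < size (above x))%N -> apex (nth x (above x) i) = odd i;
  above_adj : forall x i, (i.+1 < size (above x))%N ->
    adj (nth x (above x) i) (nth x (above x) i.+1);
  above_vertex : forall x i, (i.*2.+2 < size (above x))%N ->
    perm_eq [:: fsize x; fsize (nth x (above x) i.*2);
      fsize (nth x (above x) i.*2.+1); fsize (nth x (above x) i.*2.+2)] k;
  adj_vertex : forall x y, adj x y -> perm_eq [:: fsize x; fsize y;
    fsize (nth y (above y) 0); fsize (nth x (above x) (size (above x)).-1)] k;
  adj_above : forall x y, adj x y ->
    adj (nth x (above x) (size (above x)).-1) (nth y (above y) 0);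
  base : bool -> int -> face;
  base_apex : forall b i, apex (base b i) = false;
  base_adj : forall b i, adj (base b i) (base b (i + 1));
  base_vertex : forall i, perm_eq [:: fsize (base true i); fsize (base true (i + 1));
    fsize (base false (i + 1)); fsize (base false i)] k }.

Section Subdivision.
Variable R : realType.
Implicit Types a b x s : R.

Lemma subdiv_ltE a b n i j : a < b -> (0 < n)%N ->
  (subdiv a b n i < subdiv a b n j) = (i < j)%N.
Proof.
move=> ab n0; case: (ltngtP i j) => [ij|ji|->]; last by rewrite ltxx.
  by rewrite subdiv_lt.
by apply/negbTE; rewrite -leNgt ltW// subdiv_lt.
Qed.

Lemma subdiv_leE a b n i j : a < b -> (0 < n)%N ->
  (subdiv a b n i <= subdiv a b n j) = (i <= j)%N.
Proof. by move=> ab n0; rewrite leNgt subdiv_ltE// -leqNgt. Qed.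

Lemma subdiv_inj a b n i j : a < b -> (0 < n)%N ->
  subdiv a b n i = subdiv a b n j -> i = j.
Proof.
by move=> ab n0 e; apply/eqP; rewrite eqn_leq -!(subdiv_leE _ _ ab n0) e lexx.
Qed.

Lemma lerp0 a b : lerp a b 0 = a. Proof. by rewrite /lerp; ring. Qed.
Lemma lerp1 a b : lerp a b 1 = b. Proof. by rewrite /lerp; ring. Qed.
Lemma lerpxx a s : lerp a a s = a. Proof. by rewrite /lerp; ring. Qed.

Lemma lerp_le a b a' b' s : 0 <= s <= 1 -> a <= a' -> b <= b' ->
  lerp a b s <= lerp a' b' s.
Proof.
by move=> /andP[s0 s1] aa bb; rewrite lerD// ler_wpM2l// subr_ge0.
Qed.

Lemma lerp_lt a b a' b' s : 0 <= s <= 1 -> a < a' -> b < b' ->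
  lerp a b s < lerp a' b' s.
Proof.
move=> /andP[s0 s1] aa bb; rewrite /lerp.
have [->|sn] := eqVneq s 0; first by rewrite subr0 !mul0r !addr0 !mul1r.
by rewrite ler_ltD ?ler_wpM2l ?subr_ge0 ?(ltW aa)// ltr_pM2l// lt_neqAle eq_sym sn.
Qed.

Lemma discrete_ivt (F : nat -> R) m x : (0 < m)%N -> F 0%N <= x -> x <= F m ->
  exists2 j, (j < m)%N & F j <= x <= F j.+1.
Proof.
elim: m => // m IH _ F0 Fm; have [|Fx] := leP (F m) x.
  by exists m => //; apply/andP.
case: m IH Fm Fx => [|m] IH Fm Fx; first by rewrite leNgt Fx in F0.
by have [j jm jx] := IH isT F0 (ltW Fx); exists j => //; exact: ltnW.
Qed.
End Subdivision.

Section Rows.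
Variables (R : realType) (k : seq nat) (G : growth k).

Record cell := Cell { cface : face G; cbl : R; cbr : R; clo : R; chi : R }.
Implicit Types (c p : cell) (b : bool) (n : nat) (x s : R).

Definition nabove c := size (above (cface c)).
Definition ntop c := uphalf (nabove c).

(** The tops of the [2 * ntop c - 1] tiles above [c] divide the top of [c]
    evenly.  With [j] even, the bottom is the top side number [j./2]; with [j]
    odd, both ends of the bottom are the vertex [uphalf j]. *)
Definition child c j := Cell (nth (cface c) (above (cface c)) j)
  (subdiv (clo c) (chi c) (ntop c) (uphalf j)) (subdiv (clo c) (chi c) (ntop c) j./2.+1)
  (subdiv (clo c) (chi c) (nabove c) j) (subdiv (clo c) (chi c) (nabove c) j.+1).

Fixpoint tier b n : set cell := if n is n'.+1
  then [set c | exists2 p, tier b n' p & exists2 j, (j < nabove p)%N & c = child p j]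
  else [set Cell (base G b i) i%:~R (i + 1)%:~R i%:~R (i + 1)%:~R | i in setT].

Definition in_strip c s x := lerp (cbl c) (clo c) s <= x <= lerp (cbr c) (chi c) s.

Definition before c c' := chi c <= clo c' /\ cbr c <= cbl c'.

Lemma nabove_gt0 c : (0 < nabove c)%N.
Proof. by rewrite /nabove; case: (size _) (above_odd (cface c)). Qed.

Lemma ntop_gt0 c : (0 < ntop c)%N.
Proof. by rewrite /ntop; case: (nabove c) (nabove_gt0 c). Qed.

Lemma ntop_last c : ((nabove c).-1)./2.+1 = ntop c.
Proof. by rewrite /ntop -[_.+1]/(uphalf (nabove c).-1.+1) prednK// nabove_gt0. Qed.

Lemma half_lt_ntop c j : (j < nabove c)%N -> (j./2 < ntop c)%N.
Proof. by move=> /uphalf_leq. Qed.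

Lemma tier_lohi b n c : tier b n c -> clo c < chi c.
Proof.
elim: n c => [|n IH] c /=; first by move=> [i _ <-] /=; rewrite ltr_int ltzD1.
by move=> [p /IH ph [j jp ->]] /=; rewrite subdiv_ltE// nabove_gt0.
Qed.

Lemma tier_apex b n c : tier b n c -> (cbl c < cbr c) = ~~ apex (cface c).
Proof.
case: n => [|n] /=; first by move=> [i _ <-] /=; rewrite ltr_int ltzD1 lexx base_apex.
move=> [p /tier_lohi ph [j jp ->]] /=; rewrite subdiv_ltE ?ntop_gt0// above_apex//.
by rewrite ltnS uphalf_half; case: odd; rewrite ?add1n ?ltnn ?leqnn.
Qed.

Lemma tier_blbr b n c : tier b n c -> cbl c <= cbr c.
Proof.
case: n => [|n] /=; first by move=> [i _ <-] /=; rewrite ler_int lerDl.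
move=> [p /tier_lohi ph [j jp ->]] /=; rewrite subdiv_leE ?ntop_gt0//.
by rewrite uphalf_half; case: odd => //=; rewrite add0n.
Qed.

Lemma child_inside p j : clo p < chi p -> (j < nabove p)%N ->
  [/\ clo p <= clo (child p j), chi (child p j) <= chi p,
      clo p <= cbl (child p j) & cbr (child p j) <= chi p].
Proof.
move=> ph jp /=; have [m0 t0] := (nabove_gt0 p, ntop_gt0 p).
rewrite -[X in X <= _](subdiv0 _ (chi p) (nabove p)) subdiv_leE//.
rewrite -[X in _ <= X](subdivn (clo p) _ m0) subdiv_leE//.
rewrite -[X in X <= _](subdiv0 _ (chi p) (ntop p)) subdiv_leE//.
rewrite -[X in _ <= X](subdivn (clo p) _ t0) subdiv_leE//.
by split => //; exact: half_lt_ntop.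
Qed.

Lemma child_before p i j : clo p < chi p -> (i < j)%N ->
  before (child p i) (child p j).
Proof.
move=> ph ij; split; rewrite /= subdiv_leE ?nabove_gt0 ?ntop_gt0//.
exact: (uphalf_leq ij).
Qed.

(** Two tiles of a row are ordered both at their tops and at their bottoms,
    because the part of a row above a tile stays within the vertical band over
    the top of that tile. *)
Lemma tier_order b n c c' : tier b n c -> tier b n c' ->
  [\/ c = c', before c c' | before c' c].
Proof.
elim: n c c' => [|n IH] c c' /=.
  move=> [i _ <-] [j _ <-]; rewrite /before /= !ler_int.
  case: (ltrgtP i j) => [ij|ji|->]; last exact: Or31.
    by apply: Or32; rewrite lezD1 ij.
  by apply: Or33; rewrite lezD1 ji.
move=> [p pr [j jp ->]] [p' pr' [j' jp' ->]].
have [ph ph'] := (tier_lohi pr, tier_lohi pr').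
have [lc ch lb bh] := child_inside ph jp.
have [lc' ch' lb' bh'] := child_inside ph' jp'.
case: (IH _ _ pr pr') => [ppE|[pp _]|[pp _]].
- case: (ltngtP j j') => [lt|gt|->]; last by apply: Or31; rewrite ppE.
    by apply: Or32; rewrite -ppE; exact: child_before.
  by apply: Or33; rewrite -ppE; exact: child_before.
- apply: Or32; split; [exact: le_trans ch (le_trans pp lc')|].
  exact: le_trans bh (le_trans pp lb').
- apply: Or33; split; [exact: le_trans ch' (le_trans pp lc)|].
  exact: le_trans bh' (le_trans pp lb).
Qed.

Lemma child_glue p p' j j' : clo p < chi p -> clo p' < chi p' ->
  (j < nabove p)%N -> (j' < nabove p')%N -> before p p' ->
  chi (child p j) = clo (child p' j') ->
  [/\ chi p = clo p', j = (nabove p).-1 & j' = 0%N].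
Proof.
move=> ph ph' jp jp' [pp _] e.
have [_ ch _ _] := child_inside ph jp; have [lc' _ _ _] := child_inside ph' jp'.
have e1 : chi p = clo p' by apply/le_anti; rewrite pp (le_trans lc')// -e.
split => //.
  have e2 : chi (child p j) = chi p.
    by apply/le_anti; rewrite ch e1 e lc'.
  rewrite -(@subdivn _ (clo p) (chi p) (nabove p)) ?nabove_gt0// in e2.
  by rewrite -(subdiv_inj ph (nabove_gt0 p) e2).
have e2 : clo (child p' j') = clo p'.
  by apply/le_anti; rewrite lc' -e -e1 ch.
rewrite -[X in _ = X](subdiv0 _ (chi p') (nabove p')) in e2.
exact: (subdiv_inj ph' (nabove_gt0 p') e2).
Qed.

Lemma tier_adj b n c c' : tier b n c -> tier b n c' -> chi c = clo c' ->
  adj (cface c) (cface c') /\ cbr c = cbl c'.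
Proof.
elim: n c c' => [|n IH] c c' /=.
  by move=> [i _ <-] [j _ <-] /= /intr_inj <-; split => //; exact: base_adj.
move=> [p pr [j jp ->]] [p' pr' [j' jp' ->]] e.
have [ph ph'] := (tier_lohi pr, tier_lohi pr').
case: (tier_order pr pr') => [ppE|pp|[pp _]].
- move: jp' e; rewrite -ppE => jp' /= /(subdiv_inj ph (nabove_gt0 p)) jj; rewrite -jj.
  by split => //; apply: above_adj; rewrite jj.
- have [e1 -> ->] := child_glue ph ph' jp jp' pp e.
  have [pa _] := IH _ _ pr pr' e1; split; first exact: adj_above.
  by rewrite /= ntop_last subdivn ?ntop_gt0// subdiv0.
- have [lc _ _ _] := child_inside ph jp; have [_ ch' _ _] := child_inside ph' jp'.
  have cr : tier b n.+1 (child p j) by exists p => //; exists j.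
  have cr' : tier b n.+1 (child p' j') by exists p' => //; exists j'.
  have := tier_lohi cr; have := tier_lohi cr'; rewrite -e => l1 l2.
  by have := le_lt_trans (le_trans (le_trans (ltW l1) ch') (le_trans pp lc)) l2; rewrite ltxx.
Qed.

Lemma tier_cover b n x s : 0 <= s <= 1 -> exists2 c, tier b n c & in_strip c s x.
Proof.
elim: n s x => [|n IH] s x s01 /=.
  exists (Cell (base G b (Num.floor x)) (Num.floor x)%:~R (Num.floor x + 1)%:~R
    (Num.floor x)%:~R (Num.floor x + 1)%:~R); first by exists (Num.floor x).
  by rewrite /in_strip /= !lerpxx floor_le ltW// floorD1_gt.
have [p pr] := IH 1 x (introT andP (conj ler01 (lexx 1))).
rewrite /in_strip !lerp1 => /andP[lx xh].
pose F j := lerp (subdiv (clo p) (chi p) (ntop p) (uphalf j))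
  (subdiv (clo p) (chi p) (nabove p) j) s.
have [||j jp jx] := discrete_ivt (F := F) (x := x) (nabove_gt0 p).
- by rewrite /F !subdiv0 lerpxx.
- by rewrite /F -/(ntop p) !subdivn ?nabove_gt0 ?ntop_gt0// lerpxx.
by exists (child p j) => //; exists p => //; exists j.
Qed.

Lemma tier_next b n c : tier b n c -> exists2 c', tier b n c' & chi c = clo c'.
Proof.
elim: n c => [|n IH] c /=.
  move=> [i _ <-] /=; exists (Cell (base G b (i + 1)) (i + 1)%:~R (i + 1 + 1)%:~R
    (i + 1)%:~R (i + 1 + 1)%:~R) => //; by exists (i + 1).
move=> [p pr [j jp ->]]; have [jl|jl] := ltnP j.+1 (nabove p).
  by exists (child p j.+1) => //; exists p => //; exists j.+1.
have [p' pr' e] := IH _ pr; exists (child p' 0).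
  by exists p' => //; exists 0%N => //; exact: nabove_gt0.
have -> : j = (nabove p).-1 by lia.
by rewrite /= prednK ?nabove_gt0// subdivn ?nabove_gt0// subdiv0.
Qed.

Lemma tier_prev b n c : tier b n c -> exists2 c', tier b n c' & chi c' = clo c.
Proof.
elim: n c => [|n IH] c /=.
  move=> [i _ <-] /=; exists (Cell (base G b (i - 1)) (i - 1)%:~R (i - 1 + 1)%:~R
    (i - 1)%:~R (i - 1 + 1)%:~R); [by exists (i - 1)|by rewrite /= subrK].
move=> [p pr [[|j] jp ->]]; last first.
  by exists (child p j) => //; exists p => //; exists j => //; exact: ltnW.
have [p' pr' e] := IH _ pr; exists (child p' (nabove p').-1).
  by exists p' => //; exists (nabove p').-1 => //; rewrite ltn_predL nabove_gt0.
by rewrite /= prednK ?nabove_gt0// subdivn ?nabove_gt0// subdiv0.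
Qed.

Lemma in_strip_child p j s x : clo p < chi p -> (j < nabove p)%N ->
  0 <= s <= 1 -> in_strip (child p j) s x -> clo p <= x <= chi p.
Proof.
move=> ph jp s01 /andP[lx xh]; have [lc ch lb bh] := child_inside ph jp.
rewrite (le_trans _ lx) ?(le_trans xh)//.
  by rewrite -[X in _ <= X](lerpxx _ s) lerp_le.
by rewrite -[X in X <= _](lerpxx _ s) lerp_le.
Qed.

(** A tile of the next row lies over the top of its parent, so only the finitely
    many children of finitely many tiles can reach a bounded vertical band. *)
Lemma tier_finite b n (u v : R) : finite_set [set c | tier b n c /\
  exists2 s, 0 <= s <= 1 & exists2 x, u <= x <= v & in_strip c s x].
Proof.
elim: n => [|n IH].
  pose f (i : int) := Cell (base G b i) i%:~R (i + 1)%:~R (i%:~R : R) (i + 1)%:~R.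
  pose m := Num.floor u; pose M := Num.floor v.
  apply: (@sub_finite_set _ _ [set f (m - 1 + j%:Z) | j in `I_(`|(M - m)%R|.+3)%N]); last first.
    exact/finite_image/finite_II.
  move=> c [[i _ <-] [s s01 [x /andP[ux xv]]]]; rewrite /in_strip/= !lerpxx => /andP[ix xi].
  have mi : m <= i + 1.
    by rewrite -(ler_int R) (le_trans (floor_le u))// (le_trans ux).
  have iM : i < M + 1.
    by rewrite -(ltr_int R) (le_lt_trans ix)// (le_lt_trans xv)// floorD1_gt.
  exists `|(i - (m - 1))%R|%N; first by rewrite /=; lia.
  by have -> : m - 1 + `|(i - (m - 1))%R|%N%:Z = i by lia.
have sub : [set c | tier b n.+1 c /\
  exists2 s, 0 <= s <= 1 & exists2 x, u <= x <= v & in_strip c s x] `<=`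
  \bigcup_(p in [set c | tier b n c /\
  exists2 s, 0 <= s <= 1 & exists2 x, u <= x <= v & in_strip c s x])
  [set child p j | j in `I_(nabove p)].
  move=> c [[p pr [j jp ->]] [s s01 [x ux xc]]].
  exists p; last by exists j.
  split => //; exists 1; first by rewrite ler01 lexx.
  by exists x => //; rewrite /in_strip !lerp1; exact: in_strip_child (tier_lohi pr) jp s01 xc.
apply: sub_finite_set sub _; apply: bigcup_finite => // p _.
exact/finite_image/finite_II.
Qed.
End Rows.

(** * Intersections of tiles *)

Section Tiles.
Variables (R : realType) (k : seq nat) (G : growth k).
Local Notation cell := (cell R G).
Local Notation tier := (@tier R k G).
Implicit Types (c p : cell) (b : bool) (n : nat) (x s : R).

Definition sgn b : R := if b then 1 else -1.

Lemma sgn_neq0 b : sgn b != 0.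
Proof. by case: b; rewrite /sgn ?oppr_eq0 oner_neq0. Qed.

Definition tile_of b n c := is_trapezoid (sgn b) n%:R (cbl c) (cbr c) (clo c) (chi c) (ntop c).

Lemma tier_tile b n c : tier b n c -> exists P, tile_of b n c P.
Proof.
move=> r; apply: trapezoid_exists; [exact: sgn_neq0|exact: tier_blbr r|exact: tier_lohi r|].
exact: ntop_gt0.
Qed.

Lemma tile_choice : exists tile : bool -> nat -> cell -> polygon R,
  forall b n c, tier b n c -> tile_of b n c (tile b n c).
Proof.
have c0 : tier true 0 (Cell (base G true 0) 0%:~R (0 + 1)%:~R 0%:~R (0 + 1)%:~R) by exists 0.
have [P0 _] := tier_tile c0.
have H (i : bool * nat * cell) : exists P, tier i.1.1 i.1.2 i.2 -> tile_of i.1.1 i.1.2 i.2 P.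
  have [/tier_tile[P HP]|nr] := pselect (tier i.1.1 i.1.2 i.2); first by exists P.
  by exists P0.
have [f fP] := choice H.
by exists (fun b n c => f (b, n, c)) => b n c r; exact: fP (b, n, c) r.
Qed.

Variable tile : bool -> nat -> cell -> polygon R.
Hypothesis tileP : forall b n c, tier b n c -> tile_of b n c (tile b n c).

Definition tiles : set (polygon R) :=
  [set P | exists b n c, tier b n c /\ P = tile b n c].

Lemma regionP b n c v : tier b n c -> region (tile b n c) v <->
  exists s, [/\ 0 <= s <= 1, v.2 = sgn b * (n%:R + s) & in_strip c s v.1].
Proof. by move=> /tileP/trapezoid_region. Qed.

(** A height belongs to a single strip unless it is the common boundary of two
    strips, which are neighbours in a half-plane or the lowest ones of both. *)
Lemma height_eq b n s b' n' s' : 0 <= s <= 1 -> 0 <= s' <= 1 ->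
  sgn b * (n%:R + s) = sgn b' * (n'%:R + s') ->
  [\/ [/\ b = b', n = n' & s = s'],
      [/\ b = b', n' = n.+1, s = 1 & s' = 0],
      [/\ b = b', n = n'.+1, s = 0 & s' = 1] |
      [/\ b' = ~~ b, n = 0%N, n' = 0%N, s = 0 & s' = 0]].
Proof.
move=> /andP[s0 s1] /andP[s0' s1'] e.
have n0 := ler0n R n; have n0' := ler0n R n'.
have [bb|bb] := eqVneq b b'.
  move: e; rewrite bb => /(mulfI (sgn_neq0 b')) e.
  have lt1 : n%:R < n'.+2%:R :> R by rewrite -addn2 natrD; lra.
  have lt2 : n'%:R < n.+2%:R :> R by rewrite -addn2 natrD; lra.
  move: lt1 lt2; rewrite !ltr_nat => lt1 lt2.
  have [nn|nn|nn] := ltngtP n n'.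
  - have n'E : n' = n.+1 by lia.
    by move: e; rewrite n'E -addn1 natrD => e; apply: Or42; split => //; lra.
  - have nE : n = n'.+1 by lia.
    by move: e; rewrite nE -addn1 natrD => e; apply: Or43; split => //; lra.
  - by apply: Or41; split => //; move: e; rewrite nn; lra.
have b'E : b' = ~~ b by case: b b' bb {e} => [] [].
apply: Or44; move: e; rewrite b'E => e.
have : n%:R + s + (n'%:R + s') = 0 by move: e; rewrite /sgn; case: (b) => /=; lra.
move=> sum0; have [ne ne'] : n%:R = 0 :> R /\ n'%:R = 0 :> R by split; lra.
by move/eqP: ne; move/eqP: ne'; rewrite !pnatr_eq0 => /eqP-> /eqP->; split => //; lra.
Qed.

Definition meet_ok (P Q : polygon R) :=
  [\/ region P `&` region Q = set0,
      exists2 v, corners P v /\ corners Q v & region P `&` region Q = [set v]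
    | exists2 e, sides P e /\ sides Q e & region P `&` region Q = e].

Lemma meet_okC P Q : meet_ok P Q -> meet_ok Q P.
Proof.
rewrite /meet_ok (setIC (region Q)); case=> [e|[v [cP cQ] e]|[e [sP sQ] ee]].
- exact: Or31.
- by apply: Or32; exists v.
- by apply: Or33; exists e.
Qed.

Lemma horizontal_segment (a a' y : R) v : a <= a' -> segment (a, y) (a', y) v <->
  v.2 = y /\ a <= v.1 <= a'.
Proof.
move=> aa; split=> [/segmentP[s s01 ->] /=|].
  split; first by rewrite lerpxx.
  by rewrite -{1}(lerpxx a s) -{3}(lerpxx a' s) !lerp_le.
case: v => x z /= [-> /andP[ax xa']]; apply/segmentP => /=.
have [e|lt] := eqVneq a a'.
  exists 0; first by rewrite lexx ler01.
  by rewrite !lerp0; congr pair; apply/le_anti; rewrite ax {1}e xa'.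
have d0 : 0 < a' - a by rewrite subr_gt0 lt_neqAle lt.
exists ((x - a) / (a' - a)).
  by rewrite divr_ge0 ?subr_ge0//= ler_pdivrMr// mul1r lerD2r.
rewrite lerpxx /lerp; congr pair; field; exact: lt0r_neq0.
Qed.

(** At equal heights the right side of [c] is weakly left of the left side of
    [c'].  They touch along a whole side if the tops touch, and otherwise at
    most at a common bottom point, where a triangle stands between them. *)
Lemma meet_same_tier b n c c' : tier b n c -> tier b n c' -> before c c' ->
  meet_ok (tile b n c) (tile b n c').
Proof.
move=> r r' [hl rl].
have [hE|hN] := eqVneq (chi c) (clo c').
  have [_ rE] := tier_adj r r' hE.
  apply: Or33; exists (segment (cbr c, sgn b * n%:R) (chi c, sgn b * (n%:R + 1))).
    split; first exact: trapezoid_right (tileP r).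
    by rewrite hE rE; exact: trapezoid_left (tileP r').
  apply/seteqP; split=> [v [/(regionP _ r)[s [s01 vE /andP[_ xs]]] /(regionP _ r')[s' [s01' vE' /andP[xs' _]]]]|].
    have ss : s = s'.
      by move: vE'; rewrite vE => /(mulfI (sgn_neq0 b)) /addrI.
    apply/segmentP; exists s => //; rewrite [LHS]surjective_pairing; congr pair => /=.
      by apply/le_anti; rewrite xs hE rE ss xs'.
    by rewrite vE /lerp; ring.
  move=> v /segmentP[s s01 ->] /=.
  have vE : lerp (sgn b * n%:R) (sgn b * (n%:R + 1)) s = sgn b * (n%:R + s).
    by rewrite /lerp; ring.
  split.
    apply/(regionP _ r); exists s; split => //; rewrite /in_strip lexx andbT.
    by apply: lerp_le => //; [exact: tier_blbr r|exact/ltW/(tier_lohi r)].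
  apply/(regionP _ r'); exists s; split => //; rewrite /in_strip -hE -rE lexx /= hE rE.
  by apply: lerp_le => //; [exact: tier_blbr r'|exact/ltW/(tier_lohi r')].
have hlt : chi c < clo c' by rewrite lt_neqAle hN.
have [rE|rN] := eqVneq (cbr c) (cbl c').
  apply: Or32; exists (cbr c, sgn b * n%:R).
    split; first by apply/(trapezoid_corners (tileP r)); exact: Or32.
    by apply/(trapezoid_corners (tileP r')); rewrite rE; exact: Or31.
  apply/seteqP; split=> [v [/(regionP _ r)[s [s01 vE /andP[_ xs]]] /(regionP _ r')[s' [s01' vE' /andP[xs' _]]]]|v ->].
    have ss : s = s'.
      by move: vE'; rewrite vE => /(mulfI (sgn_neq0 b)) /addrI.
    rewrite -ss -rE in xs'; have /andP[s0 s1] := s01.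
    have sE : s = 0.
      apply/eqP; apply: contraT => sn; have sp : 0 < s by rewrite lt_neqAle eq_sym sn.
      have := le_trans xs' xs; rewrite /lerp lerD2l ler_pM2l// leNgt hlt//.
    rewrite /= [LHS]surjective_pairing vE sE addr0; congr pair.
    by move: xs xs'; rewrite sE !lerp0 => xs xs'; apply/le_anti; rewrite xs xs'.
  split.
    apply/(regionP _ r); exists 0; rewrite addr0 lexx ler01 /in_strip !lerp0 lexx andbT.
    by split => //=; rewrite andbT (tier_blbr r).
  apply/(regionP _ r'); exists 0; rewrite addr0 lexx ler01 /in_strip !lerp0 /= -rE lexx.
  by split => //=; rewrite rE (tier_blbr r').
apply: Or31; apply/seteqP; split => // v.
move=> [/(regionP _ r)[s [s01 vE /andP[_ xs]]] /(regionP _ r')[s' [s01' vE' /andP[xs' _]]]].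
have ss : s = s'.
  by move: vE'; rewrite vE => /(mulfI (sgn_neq0 b)) /addrI.
have : lerp (cbr c) (chi c) s < lerp (cbl c') (clo c') s.
  by apply: lerp_lt => //; rewrite lt_neqAle rN.
by rewrite ltNge ss (le_trans xs') // -ss.
Qed.

Lemma child_tier b n p j : tier b n p -> (j < nabove p)%N -> tier b n.+1 (child p j).
Proof. by move=> r jp; exists p => //; exists j. Qed.

Lemma meet_next_tier b n c c' v : tier b n c -> tier b n.+1 c' ->
  (region (tile b n c) `&` region (tile b n.+1 c')) v <->
  [/\ v.2 = sgn b * (n%:R + 1), clo c <= v.1 <= chi c & cbl c' <= v.1 <= cbr c'].
Proof.
move=> r r'; split.
  move=> [/(regionP _ r)[s [s01 vE xs]] /(regionP _ r')[s' [s01' vE' xs']]].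
  have := height_eq s01 s01' (etrans (esym vE) vE').
  case=> [[_ /n_Sn//]|[_ _ sE sE']|[_ e _ _]|[_ _ //]]; last by lia.
  by move: xs xs' vE; rewrite sE sE' /in_strip !lerp1 !lerp0.
move=> [vE xc xc']; split.
  by apply/(regionP _ r); exists 1; rewrite ler01 lexx /in_strip !lerp1.
apply/(regionP _ r'); exists 0; rewrite ler01 lexx /in_strip !lerp0 addr0.
by rewrite -addn1 natrD.
Qed.

(** A tile meets its children along their bottoms, and it meets a child of
    another tile only if that child is the extreme one of a horizontal
    neighbour, in a common corner. *)
Lemma meet_above b n p c' : tier b n p -> tier b n.+1 c' ->
  meet_ok (tile b n p) (tile b n.+1 c').
Proof.
move=> r r'; have [p' pr' [j jp e]] := r'.
have [ph ph'] := (tier_lohi r, tier_lohi pr').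
have top i : (i <= ntop p)%N ->
    corners (tile b n p) (subdiv (clo p) (chi p) (ntop p) i, sgn b * (n%:R + 1)).
  by move=> it; apply/(trapezoid_corners (tileP r)); apply: Or33; exists i.
have vE : n.+1%:R = n%:R + 1 :> R by rewrite -addn1 natrD.
have cl : corners (tile b n.+1 c') (cbl c', sgn b * (n%:R + 1)).
  by apply/(trapezoid_corners (tileP r')); rewrite -vE; exact: Or31.
have cr : corners (tile b n.+1 c') (cbr c', sgn b * (n%:R + 1)).
  by apply/(trapezoid_corners (tileP r')); rewrite -vE; exact: Or32.
have blbr := tier_blbr r'.
have [lc ch lb bh] : [/\ clo p' <= clo c', chi c' <= chi p', clo p' <= cbl c' & cbr c' <= chi p'].
  by rewrite e; exact: child_inside.
case: (tier_order r pr') => [pp|[pp _]|[pp _]].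
- have [sub1 sub2] : clo p <= cbl c' /\ cbr c' <= chi p by rewrite pp.
  have [lt|ge] := ltP (cbl c') (cbr c').
    apply: Or33; exists (segment (cbl c', sgn b * (n%:R + 1)) (cbr c', sgn b * (n%:R + 1))).
      split; last by have := trapezoid_bottom (tileP r') lt; rewrite vE.
      have jE : uphalf j = j./2.
        move: lt; rewrite e /= subdiv_ltE ?ntop_gt0// uphalf_half.
        by case: (odd j) => //=; rewrite ltnn.
      have := trapezoid_top (tileP r) (i := j./2).
      rewrite e /= -pp jE; apply; rewrite pp; exact: half_lt_ntop.
    apply/seteqP; split=> v.
      by move=> /(meet_next_tier _ r r')[v2 _ v1]; apply/(horizontal_segment _ _ blbr).
    move=> /(horizontal_segment _ _ blbr)[v2 /andP[v1 v1']]; apply/(meet_next_tier _ r r').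
    by split => //; apply/andP; split => //; [exact: le_trans v1|exact: le_trans sub2].
  have bE : cbr c' = cbl c' by apply/le_anti; rewrite ge blbr.
  apply: Or32; exists (cbl c', sgn b * (n%:R + 1)).
    split => //; rewrite e /= -pp; apply: top; rewrite pp.
    exact: (@uphalf_leq j (nabove p') (ltnW jp)).
  apply/seteqP; split=> [v /(meet_next_tier _ r r')[v2 _ /andP[v1 v1']]|v ->].
    rewrite /= [LHS]surjective_pairing v2; congr pair.
    by apply/le_anti; rewrite v1 -bE v1'.
  by apply/(meet_next_tier _ r r'); rewrite /= bE lexx sub1 -bE sub2.
- have [E|N] := eqVneq (chi p) (cbl c').
    apply: Or32; exists (cbl c', sgn b * (n%:R + 1)).
      by split => //; rewrite -E -(subdivn (clo p) (chi p) (ntop_gt0 p)); exact: top.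
    apply/seteqP; split=> [v /(meet_next_tier _ r r')[v2 /andP[_ v1] /andP[v1' _]]|v ->].
      rewrite /= [LHS]surjective_pairing v2; congr pair.
      by apply/le_anti; rewrite v1' -E v1.
    by apply/(meet_next_tier _ r r'); rewrite /= lexx blbr -E lexx (ltW ph).
  apply: Or31; apply/seteqP; split => // v /(meet_next_tier _ r r')[v2 /andP[_ v1] /andP[v1' _]].
  by move: N; rewrite eq_le (le_trans pp lb) (le_trans v1' v1).
- have [E|N] := eqVneq (clo p) (cbr c').
    apply: Or32; exists (cbr c', sgn b * (n%:R + 1)).
      by split => //; rewrite -E -(subdiv0 (clo p) (chi p) (ntop p)); exact: top.
    apply/seteqP; split=> [v /(meet_next_tier _ r r')[v2 /andP[v1 _] /andP[_ v1']]|v ->].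
      rewrite /= [LHS]surjective_pairing v2; congr pair.
      by apply/le_anti; rewrite v1' -E v1.
    by apply/(meet_next_tier _ r r'); rewrite /= lexx blbr -E lexx (ltW ph).
  apply: Or31; apply/seteqP; split => // v /(meet_next_tier _ r r')[v2 /andP[v1 _] /andP[_ v1']].
  by move: N; rewrite eq_le (le_trans bh pp) (le_trans v1 v1').
Qed.
End Tiles.

Section TileSystem.
Variables (R : realType) (k : seq nat) (G : growth k).
Local Notation cell := (cell R G).
Local Notation tier := (@tier R k G).
Local Notation sgn := (sgn R).
Implicit Types (c p : cell) (b : bool) (n : nat) (x s : R).
Variable tile : bool -> nat -> cell -> polygon R.
Hypothesis tileP : forall b n c, tier b n c -> tile_of b n c (tile b n c).

Definition base_cell b (i : int) : cell :=
  Cell (base G b i) i%:~R (i + 1)%:~R i%:~R (i + 1)%:~R.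

Lemma tier0P b c : tier b 0 c -> exists i, c = base_cell b i.
Proof. by move=> [i _ <-]; exists i. Qed.

Lemma tier0 b i : tier b 0 (base_cell b i). Proof. by exists i. Qed.

Lemma meet_across v i j b :
  (region (tile b 0 (base_cell b i)) `&` region (tile (~~ b) 0 (base_cell (~~ b) j))) v <->
  [/\ v.2 = 0, i%:~R <= v.1 <= (i + 1)%:~R & j%:~R <= v.1 <= (j + 1)%:~R].
Proof.
split.
  move=> [/(regionP tileP v (tier0 b i))[s [s01 vE xs]]].
  move=> /(regionP tileP v (tier0 (~~ b) j))[s' [s01' vE' xs']].
  have := height_eq s01 s01' (etrans (esym vE) vE').
  case=> [[e]|[e]|[e]|[_ _ _ sE sE']]; try by case: (b) e.
  by move: xs xs' vE; rewrite sE sE' /in_strip !lerpxx addr0 mulr0.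
move=> [vE xi xj]; split.
  apply/(regionP tileP v (tier0 b i)); exists 0.
  by rewrite ler01 lexx /in_strip !lerp0 addr0 mulr0.
apply/(regionP tileP v (tier0 (~~ b) j)); exists 0.
by rewrite ler01 lexx /in_strip !lerp0 addr0 mulr0.
Qed.

Lemma base_corners b i : corners (tile b 0 (base_cell b i)) (i%:~R, 0) /\
  corners (tile b 0 (base_cell b i)) ((i + 1)%:~R, 0).
Proof.
split; apply/(trapezoid_corners (tileP (tier0 b i))); rewrite mulr0.
  exact: Or31.
exact: Or32.
Qed.

Lemma base_bottom b i : sides (tile b 0 (base_cell b i)) (segment (i%:~R, 0) ((i + 1)%:~R, 0)).
Proof.
have := trapezoid_bottom (tileP (tier0 b i)); rewrite mulr0; apply.
by rewrite /= ltr_int ltzD1.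
Qed.

Lemma meet_base b i j : i <= j ->
  meet_ok (tile b 0 (base_cell b i)) (tile (~~ b) 0 (base_cell (~~ b) j)).
Proof.
rewrite le_eqVlt => /orP[/eqP <-|ij].
  apply: Or33; exists (segment (i%:~R, 0) ((i + 1)%:~R, 0)).
    by split; exact: base_bottom.
  have le : i%:~R <= (i + 1)%:~R :> R by rewrite ler_int lerDl.
  apply/seteqP; split=> v.
    by move=> /meet_across[v2 v1 _]; apply/(horizontal_segment _ _ le).
  by move=> /(horizontal_segment _ _ le)[v2 v1]; apply/meet_across.
have [e|ne] := eqVneq (i + 1) j.
  apply: Or32; exists (j%:~R, 0).
    by split; [rewrite -e; exact: (base_corners _ _).2|exact: (base_corners _ _).1].
  apply/seteqP; split=> [[x y] /meet_across[/= -> /andP[_ x1] /andP[x2 _]]|v ->].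
    by congr pair; apply/le_anti; rewrite x2 -e x1.
  by apply/meet_across; rewrite /= -e lexx !ler_int !lerDl.
apply: Or31; apply/seteqP; split => // v /meet_across[_ /andP[_ x1] /andP[x2 _]].
have := le_trans x2 x1; rewrite ler_int => ji.
by move/eqP: ne; apply; apply/le_anti; rewrite ji lezD1 ij.
Qed.

Lemma meet_distinct b n c b' n' c' : tier b n c -> tier b' n' c' ->
  (b, n, c) <> (b', n', c') -> meet_ok (tile b n c) (tile b' n' c').
Proof.
move=> r r' ne.
have [[bb nn]|far] := pselect (b = b' /\ n = n').
  case: bb nn r' ne => <- <- r' ne.
  case: (tier_order r r') => [cc|bf|bf]; first by case: ne; rewrite cc.
    exact: meet_same_tier.
  by apply: meet_okC; exact: meet_same_tier.
have [[bb nn]|far1] := pselect (b = b' /\ n' = n.+1).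
  by case: bb nn r' ne => <- -> r' ne; exact: meet_above.
have [[bb nn]|far2] := pselect (b = b' /\ n = n'.+1).
  by case: bb nn r ne => -> -> r ne; apply: meet_okC; exact: meet_above.
have [[bb n0 n0']|far3] := pselect [/\ b' = ~~ b, n = 0%N & n' = 0%N].
  case: bb n0 n0' r r' ne {far far1 far2} => -> -> -> /tier0P[i ->] /tier0P[j ->] _.
  case: (leP i j) => [|/ltW] ij; first exact: meet_base.
  by apply: meet_okC; have := meet_base (~~ b) ij; rewrite negbK.
apply: Or31; apply/seteqP; split => // v.
move=> [/(regionP tileP _ r)[s [s01 vE _]] /(regionP tileP _ r')[s' [s01' vE' _]]].
have := height_eq s01 s01' (etrans (esym vE) vE').
by case=> [[*]|[*]|[*]|[*]]; [case: far|case: far1|case: far2|case: far3].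
Qed.

(** A tile contains in its interior the midpoint of its middle level, which no
    other tile contains. *)
Lemma tile_inj b n c b' n' c' : tier b n c -> tier b' n' c' ->
  tile b n c = tile b' n' c' -> (b, n, c) = (b', n', c').
Proof.
move=> r r' e; pose h : R := 1 / 2.
have h01 : 0 <= h <= 1 by rewrite /h; lra.
have lt d m : tier d m.1 m.2 -> lerp (cbl m.2) (clo m.2) h < lerp (cbr m.2) (chi m.2) h.
  by move=> rd; have := tier_blbr rd; have := tier_lohi rd; rewrite /lerp /h; lra.
pose x := (lerp (cbl c) (clo c) h + lerp (cbr c) (chi c) h) / 2.
have lx : lerp (cbl c) (clo c) h < x < lerp (cbr c) (chi c) h.
  by have := lt b (n, c) r; rewrite /x /=; lra.
have : region (tile b n c) (x, sgn b * (n%:R + h)).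
  apply/(regionP tileP _ r); exists h; split => //.
  by move/andP: lx => [l1 l2]; rewrite /in_strip !ltW.
rewrite e => /(regionP tileP _ r')[s [s01 /= vE xs]].
have := height_eq h01 s01 vE.
have [h0 h1] : 0 < h /\ h < 1 by rewrite /h; lra.
case=> [[bb nn hs]|[_ _ e1 _]|[_ _ e0 _]|[_ _ _ e0 _]]; last 3 first.
- by rewrite e1 ltxx in h1.
- by rewrite e0 ltxx in h0.
- by rewrite e0 ltxx in h0.
move: r' xs; rewrite -bb -nn -hs => r' /andP[x1 x2].
case: (tier_order r r') => [->//|[bf1 bf2]|[bf1 bf2]].
  move/andP: lx => [_ lx]; have := lerp_le h01 bf2 bf1.
  by rewrite leNgt (le_lt_trans x1 lx).
move/andP: lx => [lx _]; have := lerp_le h01 bf2 bf1.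
by rewrite leNgt (lt_le_trans lx x2).
Qed.

Lemma tiles_cover : \bigcup_(P in tiles tile) region P = setT.
Proof.
apply/seteqP; split => // -[x y] _.
pose b := 0 <= y; pose n := Num.truncn `|y|; pose s := `|y| - n%:R.
have /andP[ny yn] := truncn_itv (normr_ge0 y).
have s01 : 0 <= s <= 1.
  by rewrite /s subr_ge0 ny/= lerBlDr addrC -natr1 in yn *; rewrite ltW.
have [c r xc] := tier_cover G b n x s01.
exists (tile b n c); first by exists b, n, c.
apply/(regionP tileP _ r); exists s; split => //=.
rewrite /s addrC subrK /b; case: leP => y0; first by rewrite ger0_norm//= mul1r.
by rewrite ltr0_norm//= mulN1r opprK.
Qed.

Lemma tiles_locally_finite : locally_finite (tiles tile).
Proof.
move=> [x y]; exists (ball ((x, y) : R * R) 1); first exact: nbhsx_ballx.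
pose N := (Num.truncn (`|y| + 1)).+1.
pose F b n := [set c | tier b n c /\ exists2 s, 0 <= s <= 1 &
   exists2 z, x - 1 <= z <= x + 1 & in_strip c s z].
pose I := [set (b, n) | b in [set: bool] & n in `I_N].
apply: (@sub_finite_set _ _ (\bigcup_(i in I) [set tile i.1 i.2 c | c in F i.1 i.2])).
  move=> P [[b [n [c [r ->]]]] [[z w] [/(regionP tileP _ r)[s [s01 /= wE zs]] [/= xz yw]]]].
  exists (b, n) => /=.
    exists b => //; exists n => //=.
    have nw : n%:R <= `|w|.
      rewrite wE normrM; have -> : `|sgn b| = 1.
        by case: (b); rewrite ?normrN1 ?normr1.
      rewrite mul1r ger0_norm; first by case/andP: s01 => ? _; rewrite lerDl.
      by case/andP: s01 => ? _; rewrite addr_ge0.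
    rewrite /N ltnS truncn_ge_nat ?addr_ge0// (le_trans nw)//; move: yw; rewrite /ball/= => yw.
    have : `|w| <= `|y| + `|y - w| by rewrite -{1}(subKr y w) ler_normB.
    by move: (`|w|) (`|y - w|) yw => *; lra.
  exists c => //; split => //; exists s => //; exists z => //.
  move: xz; rewrite /ball/= ltr_norml => /andP[? ?]; apply/andP; split; lra.
apply: bigcup_finite; last first.
  by move=> [b n] _ /=; apply: finite_image; exact: tier_finite.
apply: finite_image2; [exact: finite_finset|exact: finite_II].
Qed.

Lemma tiles_tiling : tiling (tiles tile).
Proof.
split; [exact: tiles_cover|exact: tiles_locally_finite|].
move=> P Q [b [n [c [r ->]]]] [b' [n' [c' [r' ->]]]] ne.
by apply: meet_distinct => // e; apply: ne; case: e => -> -> ->.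
Qed.
End TileSystem.

(** * Tiles around a vertex *)

Section VertexTypes.
Variables (R : realType) (k : seq nat) (G : growth k).
Local Notation cell := (cell R G).
Local Notation tier := (@tier R k G).
Local Notation sgn := (sgn R).
Implicit Types (c p : cell) (b : bool) (n : nat) (x s : R).
Variable tile : bool -> nat -> cell -> polygon R.
Hypothesis tileP : forall b n c, tier b n c -> tile_of b n c (tile b n c).

Lemma adjacent_atI (v : R * R) (P Q : polygon R) e :
  sides P e -> sides Q e -> e v -> adjacent_at v P Q.
Proof. by move=> sP sQ ev; apply/asboolP; exists e. Qed.

Lemma tile_size b n c : tier b n c -> psize (tile b n c) = fsize (cface c).
Proof.
by move=> r; rewrite (trapezoid_size (tileP r)) (tier_apex r) fsizeE.
Qed.

Lemma natr_succ n : n.+1%:R = n%:R + 1 :> R.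
Proof. by rewrite -addn1 natrD. Qed.

Lemma region_on_line b n x b' n' c' : tier b' n' c' ->
  region (tile b' n' c') (x, sgn b * (n%:R + 1)) <-> b' = b /\
  (n' = n /\ clo c' <= x <= chi c' \/ n' = n.+1 /\ cbl c' <= x <= cbr c').
Proof.
move=> r'; have o1 : 0 <= (1 : R) <= 1 by rewrite ler01 lexx.
have o0 : 0 <= (0 : R) <= 1 by rewrite ler01 lexx.
have n01 : (1 : R) <> 0 by apply/eqP; rewrite oner_neq0.
split.
  move=> /(regionP tileP _ r')[s [s01 /= vE xs]].
  have := height_eq o1 s01 vE.
  case=> [[-> -> sE]|[-> -> _ sE]|[_ _ /n01 //]|[_ _ _ /n01 //]].
    by move: xs; rewrite -sE /in_strip !lerp1; split=> //; left.
  by move: xs; rewrite sE /in_strip !lerp0; split=> //; right.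
move=> [bE [[nE xs]|[nE xs]]]; rewrite bE nE in r' *; apply/(regionP tileP _ r').
  by exists 1; rewrite /in_strip !lerp1.
by exists 0; rewrite /in_strip !lerp0 natr_succ addr0.
Qed.

Lemma child_inj c i j : clo c < chi c -> child c i = child c j -> i = j.
Proof. by move=> ch /(congr1 (@clo _ _ _)) /= /(subdiv_inj ch (nabove_gt0 c)). Qed.

Lemma side_between b n c c' (v : R * R) : tier b n c -> tier b n c' ->
  chi c = clo c' -> v = (cbr c, sgn b * n%:R) \/ v = (chi c, sgn b * (n%:R + 1)) ->
  adjacent_at v (tile b n c) (tile b n c').
Proof.
move=> r r' e vE; have [_ e'] := tier_adj r r' e.
apply: (adjacent_atI (trapezoid_right (tileP r))).
  by rewrite e e'; exact: trapezoid_left (tileP r').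
by case: vE => ->; [exact: segment_left|exact: segment_right].
Qed.

Lemma side_above b n p i (v : R * R) : tier b n p -> (i < ntop p)%N ->
  v = (subdiv (clo p) (chi p) (ntop p) i, sgn b * (n%:R + 1)) \/
  v = (subdiv (clo p) (chi p) (ntop p) i.+1, sgn b * (n%:R + 1)) ->
  adjacent_at v (tile b n p) (tile b n.+1 (child p i.*2)).
Proof.
move=> r it vE; have ip : (i.*2 < nabove p)%N by rewrite -gtn_uphalf_double.
have r' := child_tier r ip.
apply: (adjacent_atI (trapezoid_top (tileP r) it)).
  have := trapezoid_bottom (tileP r'); rewrite /= uphalf_double doubleK natr_succ; apply.
  by rewrite subdiv_ltE ?ntop_gt0 ?(tier_lohi r).
by case: vE => ->; [exact: segment_left|exact: segment_right].
Qed.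

Lemma adjacent_atC (v : R * R) (P Q : polygon R) : adjacent_at v P Q -> adjacent_at v Q P.
Proof. by move=> /asboolP[e [sP sQ ev]]; exact: adjacent_atI sQ sP ev. Qed.

Lemma tiles_tile b n c : tier b n c -> tiles tile (tile b n c).
Proof. by move=> r; exists b, n, c. Qed.

Lemma uniq4 (T : eqType) (x y z w : T) : x <> y -> x <> z -> x <> w -> y <> z ->
  y <> w -> z <> w -> uniq [:: x; y; z; w].
Proof. by move=> *; rewrite /= !inE !negb_or; do ![apply/andP; split]; apply/eqP. Qed.

(** Around an inner vertex of a top there are the tile below and three of its
    children. *)
Lemma vertex_inside b n c j : tier b n c -> (j.+1 < ntop c)%N ->
  exists2 s, vertex_type (tiles tile)
    (subdiv (clo c) (chi c) (ntop c) j.+1, sgn b * (n%:R + 1)) s & perm_eq s k.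
Proof.
move=> r jt; set v := (_, _); have ch := tier_lohi r.
have tm : (ntop c).*2 = (nabove c).+1 by rewrite odd_uphalfK// above_odd.
have j0 : (j.*2 < nabove c)%N by lia.
have j1 : (j.*2.+1 < nabove c)%N by lia.
have j2 : (j.*2.+2 < nabove c)%N by lia.
have [r0 r1 r2] := And3 (child_tier r j0) (child_tier r j1) (child_tier r j2).
pose fs := [:: tile b n c; tile b n.+1 (child c j.*2);
  tile b n.+1 (child c j.*2.+1); tile b n.+1 (child c j.*2.+2)].
exists [seq psize P | P <- fs]; last first.
  rewrite /= (tile_size r) (tile_size r0) (tile_size r1) (tile_size r2).
  exact: above_vertex j2.
exists fs; split => //.
- apply: uniq4.
  + by move=> /(tile_inj tileP r r0)[] /n_Sn.
  + by move=> /(tile_inj tileP r r1)[] /n_Sn.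
  + by move=> /(tile_inj tileP r r2)[] /n_Sn.
  + by move=> /(tile_inj tileP r0 r1) e; have := child_inj ch (congr1 snd e); lia.
  + by move=> /(tile_inj tileP r0 r2) e; have := child_inj ch (congr1 snd e); lia.
  + by move=> /(tile_inj tileP r1 r2) e; have := child_inj ch (congr1 snd e); lia.
- move=> P; rewrite !inE; split.
    have [le1 le2] : clo c <= v.1 /\ v.1 <= chi c.
      rewrite -[X in X <= _](subdiv0 (clo c) (chi c) (ntop c)).
      rewrite -[X in _ /\ _ <= X](subdivn (clo c) (chi c) (ntop_gt0 c)).
      by rewrite !subdiv_leE ?ntop_gt0// (ltnW jt).
    case/or4P => /eqP ->; split; try exact: tiles_tile.
    + by apply/(region_on_line _ _ _ r); split=> //; left; rewrite le1 le2.
    + apply/(region_on_line _ _ _ r0); split=> //; right; split=> //=.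
      by rewrite !subdiv_leE ?ntop_gt0// uphalf_double doubleK leqnn leqnSn.
    + apply/(region_on_line _ _ _ r1); split=> //; right; split=> //=.
      by rewrite !subdiv_leE ?ntop_gt0// doubleK uphalf_double !leqnn.
    + apply/(region_on_line _ _ _ r2); split=> //; right; split=> //=.
      by rewrite !subdiv_leE ?ntop_gt0// doubleK uphalf_double leqnn leqnSn.
  move=> [[b' [n' [c' [r' ->]]]] /(region_on_line _ _ _ r')[bb H]].
  move: r' H; rewrite bb => r' [[nn]|[nn]]; move: r'; rewrite nn => r' /andP[x1 x2].
    case: (tier_order r r') => [<-|[bf _]|[bf _]]; first by rewrite eqxx.
      have := le_trans bf x1; rewrite -[X in X <= _](subdivn (clo c) (chi c) (ntop_gt0 c)).
      by rewrite subdiv_leE ?ntop_gt0// leqNgt jt.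
    have := le_trans x2 bf; rewrite -[X in _ <= X](subdiv0 (clo c) (chi c) (ntop c)).
    by rewrite subdiv_leE ?ntop_gt0.
  have [p pr [i ip e]] := r'.
  have [lc hc lb bh] := child_inside (tier_lohi pr) ip; rewrite -e in lc hc lb bh.
  case: (tier_order r pr) => [pE|[bf _]|[bf _]].
  - move: x1 x2 ip; rewrite e -pE /= !subdiv_leE ?ntop_gt0// => x1 x2 ip.
    have [->|->|->] : [\/ i = j.*2, i = j.*2.+1 | i = j.*2.+2].
      have : [|| i == j.*2, i == j.*2.+1 | i == j.*2.+2] by lia.
      by case/or3P => /eqP; [exact: Or31|exact: Or32|exact: Or33].
    + by rewrite eqxx ?orbT.
    + by rewrite eqxx ?orbT.
    + by rewrite eqxx ?orbT.
  - have := le_trans (le_trans bf lb) x1.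
    rewrite -[X in X <= _](subdivn (clo c) (chi c) (ntop_gt0 c)).
    by rewrite subdiv_leE ?ntop_gt0// leqNgt jt.
  - have := le_trans x2 (le_trans bh bf).
    rewrite -[X in _ <= X](subdiv0 (clo c) (chi c) (ntop c)).
    by rewrite subdiv_leE ?ntop_gt0.
- have hE : v = (cbr (child c j.*2), sgn b * n.+1%:R).
    by rewrite /v /= doubleK natr_succ.
  have hE' : v = (cbr (child c j.*2.+1), sgn b * n.+1%:R).
    by rewrite /v /= uphalf_double natr_succ.
  rewrite /= andbT; apply/and4P; split.
  + by apply: side_above => //; [lia|right].
  + by apply: side_between => //; left.
  + by apply: side_between => //; left.
  + by apply: adjacent_atC; rewrite -doubleS; apply: side_above => //; left.
Qed.

Lemma tier_at b n c c' d : tier b n c -> tier b n c' -> tier b n d ->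
  chi c = clo c' -> clo d <= chi c <= chi d -> d = c \/ d = c'.
Proof.
move=> r r' rd e /andP[d1 d2].
case: (tier_order r rd) => [->|[bf _]|[bf _]]; first by left.
  right; case: (tier_order r' rd) => [//|[bf' _]|[bf' _]].
    have := lt_le_trans (tier_lohi r') (le_trans bf' d1).
    by rewrite e ltxx.
  have := lt_le_trans (tier_lohi rd) (le_trans bf' (le_trans _ bf)).
  by rewrite e lexx ltxx => /(_ isT).
have := lt_le_trans (tier_lohi r) (le_trans d2 bf).
by rewrite ltxx.
Qed.

(** Where two tops meet there are two tiles below, the first child of the right
    one and the last child of the left one. *)
Lemma vertex_end b n c c' : tier b n c -> tier b n c' -> chi c = clo c' ->
  exists2 s, vertex_type (tiles tile) (chi c, sgn b * (n%:R + 1)) s & perm_eq s k.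
Proof.
move=> r r' e; set v := (_, _).
have [ch ch'] := (tier_lohi r, tier_lohi r').
have m0 := nabove_gt0 c; have tm : (ntop c).*2 = (nabove c).+1 by rewrite odd_uphalfK// above_odd.
have jc : ((nabove c).-1 < nabove c)%N by rewrite ltn_predL.
have [q q'] := (child_tier r jc, child_tier r' (nabove_gt0 c')).
have cE : chi (child c (nabove c).-1) = chi c by rewrite /= prednK// subdivn.
have cE' : clo (child c' 0) = clo c' by rewrite /= subdiv0.
have bE : cbr (child c (nabove c).-1) = chi c by rewrite /= ntop_last subdivn// ntop_gt0.
have bE' : cbl (child c' 0) = clo c' by rewrite /= subdiv0.
have ee : chi (child c (nabove c).-1) = clo (child c' 0) by rewrite cE cE'.
have [pa _] := tier_adj r r' e.
pose fs := [:: tile b n c; tile b n c'; tile b n.+1 (child c' 0);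
  tile b n.+1 (child c (nabove c).-1)].
have cc' : c <> c' by move=> cc; move: ch; rewrite e cc ltxx.
exists [seq psize P | P <- fs]; last first.
  rewrite /= (tile_size r) (tile_size r') (tile_size q) (tile_size q').
  exact: adj_vertex.
exists fs; split => //.
- apply: uniq4.
  + by move=> /(tile_inj tileP r r')[].
  + by move=> /(tile_inj tileP r q')[] /n_Sn.
  + by move=> /(tile_inj tileP r q)[] /n_Sn.
  + by move=> /(tile_inj tileP r' q')[] /n_Sn.
  + by move=> /(tile_inj tileP r' q)[] /n_Sn.
  + move=> /(tile_inj tileP q' q) /(congr1 snd) /= E.
    by have := tier_lohi q; rewrite -{1}E ee ltxx.
- move=> P; rewrite !inE; split.
    case/or4P => /eqP ->; split; try exact: tiles_tile.
    + by apply/(region_on_line _ _ _ r); split=> //; left; rewrite lexx ltW.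
    + by apply/(region_on_line _ _ _ r'); split=> //; left; rewrite e lexx ltW.
    + by apply/(region_on_line _ _ _ q'); split=> //; right; rewrite e bE' lexx -bE' (tier_blbr q').
    + by apply/(region_on_line _ _ _ q); split=> //; right; rewrite bE lexx andbT -bE (tier_blbr q).
  move=> [[b' [n' [d [rd ->]]]] /(region_on_line _ _ _ rd)[bb H]].
  move: rd H; rewrite bb => rd [[nn]|[nn]]; move: rd; rewrite nn => rd x12.
    by case: (tier_at r r' rd e x12) => ->; rewrite eqxx ?orbT.
  have [p pr [i ip dE]] := rd; have /andP[x1 x2] := x12.
  have [_ _ lb bh] := child_inside (tier_lohi pr) ip; rewrite -dE in lb bh.
  have pin : clo p <= chi c <= chi p by rewrite (le_trans lb x1) (le_trans x2 bh).
  case: (tier_at r r' pr e pin) => pE.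
    move: x2 ip; rewrite dE pE -[X in X <= _](subdivn (clo c) (chi c) (ntop_gt0 c)) /=.
    rewrite subdiv_leE ?ntop_gt0// => x2 ip.
    have -> : i = (nabove c).-1 by clear -x2 ip tm; lia.
    by rewrite eqxx !orbT.
  move: x1; rewrite dE pE e -[X in _ <= X](subdiv0 (clo c') (chi c') (ntop c')) /=.
  rewrite subdiv_leE ?ntop_gt0// => x1.
  have -> : i = 0%N by clear -x1; lia.
  by rewrite eqxx !orbT.
- have l0 := segment_left; rewrite /= andbT; apply/and4P; split.
  + by apply: side_between => //; right.
  + by apply: side_above (ntop_gt0 c') _ => //; left; rewrite subdiv0 -e.
  + by apply/adjacent_atC/side_between => //; left; rewrite bE natr_succ.
  + have -> : (nabove c).-1 = ((ntop c).-1).*2 by lia.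
    apply/adjacent_atC/side_above => //; first by rewrite ltn_predL ntop_gt0.
    by right; rewrite prednK ?ntop_gt0// subdivn ?ntop_gt0.
Qed.

Lemma vertex_top b n c i : tier b n c -> (i <= ntop c)%N ->
  exists2 s, vertex_type (tiles tile)
    (subdiv (clo c) (chi c) (ntop c) i, sgn b * (n%:R + 1)) s & perm_eq s k.
Proof.
move=> r; case: i => [|i] it.
  by have [c' r' e] := tier_prev r; rewrite subdiv0 -e; exact: vertex_end e.
have [it'|ti] := ltnP i.+1 (ntop c); first exact: vertex_inside.
have -> : i.+1 = ntop c by lia.
have [c' r' e] := tier_next r; rewrite subdivn ?ntop_gt0//; exact: vertex_end e.
Qed.

Lemma region_on_base x b c : tier b 0 c ->
  region (tile b 0 c) (x, 0) <-> cbl c <= x <= cbr c.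
Proof.
move=> r; split=> [/(regionP tileP _ r)[s [/andP[s0 _] /= e xs]]|xs].
  have s00 : s = 0.
    by move/esym/eqP: e; rewrite add0r mulf_eq0 (negPf (sgn_neq0 _ b)) /= => /eqP.
  by move: xs; rewrite s00 /in_strip !lerp0.
apply/(regionP tileP _ r); exists 0.
by rewrite lexx ler01 /in_strip !lerp0 addr0 mulr0.
Qed.

Lemma vertex_base i :
  exists2 s, vertex_type (tiles tile) ((i + 1)%:~R, 0) s & perm_eq s k.
Proof.
set v := (_, _); pose bc := @base_cell R k G.
have t0 b j : tier b 0 (bc b j) by exact: tier0.
pose fs := [:: tile true 0 (bc true i); tile true 0 (bc true (i + 1));
  tile false 0 (bc false (i + 1)); tile false 0 (bc false i)].
exists [seq psize P | P <- fs]; last by rewrite /= !(tile_size (t0 _ _)); exact: base_vertex.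
have bcE b : bc b i <> bc b (i + 1).
  by move=> /(congr1 (@clo _ _ _)) /= /intr_inj; lia.
exists fs; split => //.
- apply: uniq4; try by move=> /(tile_inj tileP (t0 _ _) (t0 _ _)) [].
  + by move=> /(tile_inj tileP (t0 _ _) (t0 _ _)) /(congr1 snd); exact: bcE.
  + by move=> /(tile_inj tileP (t0 _ _) (t0 _ _)) /(congr1 snd) /esym; exact: bcE.
- move=> P; rewrite !inE; split.
    by case/or4P => /eqP ->; (split; first exact: tiles_tile);
      apply/(region_on_base _ (t0 _ _)); rewrite /= !ler_int; lia.
  move=> [[b [n [c [r ->]]]]].
  case: n r => [|n] r.
    have [j cj] := tier0P r; move: r; rewrite cj => r /(region_on_base _ r) /=.
    rewrite !ler_int => ij; have [->|->] : j = i \/ j = i + 1 by lia.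
      by case: (b); rewrite eqxx ?orbT.
    by case: (b); rewrite eqxx ?orbT.
  move=> /(regionP tileP _ r)[s [/andP[s0 _] /= e _]].
  move/esym/eqP: e; rewrite mulf_eq0 (negPf (sgn_neq0 _ b)) /= gt_eqF//.
  by rewrite ltr_pwDl// ltr0n.
- have side0 b : adjacent_at v (tile b 0 (bc b i)) (tile b 0 (bc b (i + 1))).
    by apply: side_between => //; left; rewrite mulr0.
  rewrite /= andbT; apply/and4P; split => //.
  + apply: adjacent_atI (base_bottom tileP true (i + 1)) (base_bottom tileP false (i + 1)) _.
    exact: segment_left.
  + exact: adjacent_atC.
  + apply: adjacent_atI (base_bottom tileP false i) (base_bottom tileP true i) _.
    exact: segment_right.
Qed.

(** The bottom corners of a tile are top vertices of its parent, or lie on the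
    axis. *)
Lemma vertex_corner b n c (v : R * R) : tier b n c -> corners (tile b n c) v ->
  exists2 s, vertex_type (tiles tile) v s & perm_eq s k.
Proof.
move=> r /(trapezoid_corners (tileP r)); case=> [->|->|[i it ->]]; last exact: vertex_top.
  case: n r => [|n] r.
    have [i ->] := tier0P r; rewrite mulr0 /=.
    by have := vertex_base (i - 1); rewrite subrK.
  have [p pr [j jp ->]] := r; rewrite natr_succ; apply: vertex_top => //.
  exact: (uphalf_leq (ltnW jp)).
case: n r => [|n] r.
  by have [i ->] := tier0P r; rewrite mulr0 /=; exact: vertex_base.
have [p pr [j jp ->]] := r; rewrite natr_succ; apply: vertex_top => //.
exact: half_lt_ntop.
Qed.

Lemma tiles_pseudo_homogeneous : pseudo_homogeneous_tiling (tiles tile) k.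
Proof.
split; first exact: tiles_tiling.
by move=> v [P [b [n [c [r ->]]]] cv]; exact: vertex_corner cv.
Qed.
End VertexTypes.

Theorem growth_tiling (R : realType) (k : seq nat) (G : growth k) :
  exists T : set (polygon R), pseudo_homogeneous_tiling T k.
Proof.
have [tile tileP] := tile_choice R G.
by exists (tiles tile); exact: tiles_pseudo_homogeneous.
Qed.

(** * Streams of sizes along a lateral boundary *)

Local Open Scope nat_scope.

(** The sides that separate two horizontal neighbours, their last and first
    children, and so on, form an infinite path.  The tiles on one side of this
    path carry labels that are eventually 2-periodic: the triple [(a, b, c)]
    stands for the sequence a, b, c, b, c, b, ... *)
Definition stream := (nat * nat * nat)%type.
Definition now (s : stream) := s.1.1.
Definition next1 (s : stream) := s.1.2.
Definition next2 (s : stream) := s.2.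
Definition later (s : stream) : stream := (next1 s, next2 s, next1 s).

Section Streams.
Variable K : seq nat.

(** The two sides of a path: every vertex of the path sees two consecutive
    labels of each side, and by periodicity two vertices suffice. *)
Definition compat (U W : stream) :=
  perm_eq [:: now U; now W; next1 U; next1 W] K &&
  perm_eq [:: next2 U; next2 W; next1 U; next1 W] K.

Lemma compat_later U W : compat U W -> compat (later U) (later W).
Proof.
move=> /andP[_ /permP UW]; apply/andP.
by split; apply/permP => p; rewrite -UW /later /now /next1 /next2 /=; lia.
Qed.

(** The pairs of labels on the two sides alternate between [u, w] and [x, y]; only
    their order is free, at the next step ([swap]) and at the one after ([flip]),
    and from there on the order is kept by periodicity. *)
Definition boundary (u w x y : nat) (swap flip : bool) : stream * stream :=
  ((u, if swap then y else x, if flip then w else u),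
   (w, if swap then x else y, if flip then u else w)).

Lemma boundary_compat u w x y b1 b2 : perm_eq [:: u; w; x; y] K ->
  compat (boundary u w x y b1 b2).1 (boundary u w x y b1 b2).2.
Proof.
move=> /permP H; rewrite /compat.
by apply/andP; split; apply/permP => p; rewrite -H; case: b1 b2 => [] []; rewrite /now /next1 /next2 /=; lia.
Qed.

Definition bits := [:: (false, false); (false, true); (true, false); (true, true)].

(** All ways to continue a row over a tile of label [f] from a trapezoid with
    left stream [EL]: the entry holds the right stream of that trapezoid, both
    streams of the triangle after it, and the left stream of the trapezoid after
    the triangle. *)
Definition crossings (f : nat) (EL : stream) : seq ((stream * stream) * (stream * stream)) :=
  if (f \in K) && (now EL \in rem f K) then
    if rem (now EL) (rem f K) is [:: x; y] then
      [seq (boundary (now EL) mh.1 f mh.2 b.1.1 b.1.2,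
            boundary mh.1 mh.2 (now EL) f b.2.1 b.2.2) |
        mh <- [:: (x, y); (y, x)], b <- [seq (b, c) | b <- bits, c <- bits]]
    else [::]
  else [::].

Lemma crossingsP f EL q : q \in crossings f EL ->
  [/\ now q.1.1 = now EL, now q.1.2 = now q.2.1, compat q.1.1 q.1.2,
      compat q.2.1 q.2.2 & perm_eq [:: f; now EL; now q.1.2; now q.2.2] K].
Proof.
rewrite /crossings; case: ifP => // /andP[fK hK].
have /permP fE := perm_to_rem fK; have /permP hE := perm_to_rem hK.
case r2: (rem _ _) => [|x [|y [|z r]]] //.
have H : perm_eq [:: f; now EL; x; y] K.
  by apply/permP => p; rewrite fE /= hE r2.
have HC : perm_eq [:: f; now EL; y; x] K.
  by apply/permP => p; rewrite -(permP H) /=; lia.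
move=> /allpairsP[[[m h] b] /= [mh _ ->]] /=.
have {}H : perm_eq [:: f; now EL; m; h] K.
  by move: mh; rewrite !inE => /orP[] /eqP[-> ->].
split => //; apply: boundary_compat; apply/permP => p; rewrite -(permP H) /=; lia.
Qed.

Variable good : bool -> stream -> stream -> bool.

(** A row of [n.+1] trapezoids and [n] triangles over a tile of label [f] with
    prescribed outer streams, in which all tiles are [good]; the boolean is
    [true] for triangles. *)
Fixpoint chain (f n : nat) (EL R : stream) : bool :=
  if n is n'.+1 then
    has (fun q => [&& good false EL q.1.1, good true q.1.2 q.2.1 & chain f n' q.2.2 R])
      (crossings f EL)
  else good false EL R.

Variable sz : nat -> nat.
Definition tops (b : bool) f := sz f - (2 + ~~ b).

Hypothesis good_now : forall b L R, good b L R -> now L = now R.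
Hypothesis good_tops : forall b L R, good b L R -> 0 < tops b (now L).
Hypothesis good_chain : forall b L R, good b L R ->
  chain (now L) (tops b (now L)).-1 (later L) (later R).

Definition state := {x : bool * (stream * stream) | good x.1 x.2.1 x.2.2}.
Implicit Types (x y : state).
Definition kind x := (val x).1.
Definition lstream x := (val x).2.1.
Definition rstream x := (val x).2.2.
Definition ssize x := sz (now (lstream x)).
Definition sadj x y := compat (rstream x) (lstream y).

Lemma now_rstream x : now (rstream x) = now (lstream x).
Proof. by rewrite /rstream /lstream; case: x => -[b [L R]] /= /good_now. Qed.

(** The row found by [chain], as a list of states. *)
Fixpoint linked (f : nat) (EL : stream) (us : seq state) (R : stream) : Prop :=
  match us with
  | [:: e] => [/\ kind e = false, lstream e = EL & rstream e = R]
  | e :: m :: us' => exists EL', [/\ kind e = false, lstream e = EL, kind m = true,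
      sadj e m & compat (rstream m) EL' /\
      perm_eq [:: f; now EL; now (lstream m); now EL'] K /\ linked f EL' us' R]
  | _ => False
  end.

Lemma chain_linked f n EL R : chain f n EL R ->
  exists2 us, size us = n.*2.+1 & linked f EL us R.
Proof.
elim: n EL => [|n IH] EL /=.
  by move=> g; exists [:: exist _ (false, (EL, R)) g].
move=> /hasP[q qc /and3P[g1 g2 /IH[us us_size us_linked]]].
have [h1 h2 c1 c2 pK] := crossingsP qc.
exists [:: exist _ (false, (EL, q.1.1)) g1, exist _ (true, (q.1.2, q.2.1)) g2 & us].
  by rewrite /= us_size.
by exists q.2.2; split.
Qed.

Lemma kids_exist x : exists us, [/\ size us = (tops (kind x) (now (lstream x))).-1.*2.+1 &
  linked (now (lstream x)) (later (lstream x)) us (later (rstream x))].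
Proof.
case: x => -[b [L R]] g; have [us ? ?] := chain_linked (good_chain g).
by exists us.
Qed.

(** Rows are consumed two tiles at a time. *)
Lemma linked_ind2 (P : seq state -> Prop) : P [::] -> (forall e, P [:: e]) ->
  (forall e m us, P us -> P [:: e, m & us]) -> forall us, P us.
Proof.
move=> P0 P1 P2; fix IH 1 => -[|e [|m us]]; [exact: P0|exact: P1|exact: P2 (IH us)].
Qed.

Lemma linked_head f EL us R d : linked f EL us R -> lstream (nth d us 0) = EL.
Proof. by case: us => [|e [|m us']] //=; [case|case=> EL' []]. Qed.

Lemma linked_kind f EL us R d i : linked f EL us R -> i < size us ->
  kind (nth d us i) = odd i.
Proof.
elim/linked_ind2: us EL i => [//|e|e m us IH] EL i; first by case=> [ke _ _]; case: i.
move=> [EL' [ke _ km _ [_ [_ H]]]]; case: i => [|[|i]] //= iu.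
by rewrite negbK; exact: IH H iu.
Qed.

Lemma linked_last f EL us R d : linked f EL us R -> rstream (nth d us (size us).-1) = R.
Proof.
elim/linked_ind2: us EL => [//|e|e m us IH] EL; first by case.
by move=> [EL' [_ _ _ _ [_ [_ H]]]]; case: us H IH => // e' us H IH; exact: IH H.
Qed.

Lemma linked_adj f EL us R d i : linked f EL us R -> i.+1 < size us ->
  sadj (nth d us i) (nth d us i.+1).
Proof.
elim/linked_ind2: us EL i => [//|e|e m us IH] EL i; first by [].
move=> [EL' [_ _ _ em [mE [_ H]]]]; case: i => [|[|i]] //= iu.
  by rewrite /sadj (linked_head d H).
exact: IH H iu.
Qed.

Lemma linked_vertex f EL us R d i : linked f EL us R -> i.*2.+2 < size us ->
  perm_eq [:: sz f; ssize (nth d us i.*2); ssize (nth d us i.*2.+1);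
    ssize (nth d us i.*2.+2)] (map sz K).
Proof.
elim/linked_ind2: us EL i => [//|e|e m us IH] EL i; first by [].
move=> [EL' [_ eE _ _ [_ [pK H]]]]; case: i => [|i] iu; last exact: IH H iu.
by rewrite /= /ssize eE (linked_head d H) (perm_map sz pK).
Qed.

Section Growth.
Variable base : bool -> int -> state.
Hypothesis base_kind : forall b i, kind (base b i) = false.
Hypothesis base_sadj : forall b i, sadj (base b i) (base b (i + 1)%R).
Hypothesis base_perm : forall i, perm_eq [:: now (lstream (base true i));
  now (lstream (base true (i + 1)%R)); now (lstream (base false (i + 1)%R));
  now (lstream (base false i))] K.

Lemma stream_growth : inhabited (growth (map sz K)).
Proof.
have [kids kidsP] := choice kids_exist.
have kids_linked x := (kidsP x).2; have kids_size x := (kidsP x).1.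
have tops_gt0 x : 0 < tops (kind x) (now (lstream x)).
  by case: x => -[b [L R]] g; exact: good_tops g.
constructor; apply: (@Growth (map sz K) state ssize kind kids sadj) base _ _ _ => //.
- by move=> x; rewrite kids_size /= odd_double.
- move=> x; rewrite kids_size /= doubleK prednK// /tops /ssize.
  by have := tops_gt0 x; rewrite /tops; lia.
- by move=> x i; exact: linked_kind (kids_linked x).
- by move=> x i; exact: linked_adj (kids_linked x).
- by move=> x i; exact: linked_vertex (kids_linked x).
- move=> x y /andP[/(perm_map sz) pK _].
  have lastE : now (lstream (nth x (kids x) (size (kids x)).-1)) = next1 (rstream x).
    by rewrite -now_rstream (linked_last x (kids_linked x)).
  rewrite /ssize lastE (linked_head y (kids_linked y)) -now_rstream.
  by apply/permP => p; rewrite -(permP pK) /later /next1 /now /=; lia.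
- move=> x y /compat_later; rewrite /sadj (linked_head y (kids_linked y)).
  by rewrite (linked_last x (kids_linked x)).
- by move=> i; exact: (perm_map sz (base_perm i)).
Qed.
End Growth.
End Streams.

(** * Sets of states closed under growth *)

Section Closed.
Variables (K : seq nat) (good : bool -> stream -> stream -> bool)
  (usable : stream -> bool) (lo : nat -> nat) (rigid : nat -> bool) (reach : nat).

Definition all_streams : seq stream :=
  [seq (ab, c) | ab <- [seq (a, b) | a <- iota 0 4, b <- iota 0 4], c <- iota 0 4].

(** The outer streams of the rows over a tile of label [f], on either side. *)
Definition starts f := [seq later L | L <- all_streams & usable L && (now L == f)].

(** Rows with [reach] triangles join any two outer streams, and from any outer
    stream one trapezoid and one triangle lead to another outer stream; hence
    longer rows join any two outer streams as well, and this reduces all large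
    sizes to a finite check. *)
Definition closed_long f := all (fun EL =>
  all (chain K good f reach EL) (starts f) &&
  has (fun q => [&& good false EL q.1.1, good true q.1.2 q.2.1 & q.2.2 \in starts f])
    (crossings K f EL)) (starts f).

(** A good state must have a row above it for all admissible sizes of its label,
    which is [lo] exactly if the label is [rigid] and any size from [lo] on
    otherwise; [closed_long] covers the rows with [reach] or more triangles. *)
Definition closed_at b L R :=
  let n := lo (now L) - (2 + ~~ b) in
  [&& usable L, usable R, now L == now R, 0 < n &
    all (fun m => chain K good (now L) m (later L) (later R))
      (if rigid (now L) then [:: n.-1] else iota n.-1 (reach - n.-1))].

Definition closed_rule :=
  all (fun f => rigid f || closed_long f) (iota 0 4) &&
  all (fun b => all (fun L => all (fun R => if good b L R then closed_at b L R else true)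
    all_streams) all_streams) [:: false; true].

Lemma mem_all_streams (s : stream) :
  (s \in all_streams) = [&& now s < 4, next1 s < 4 & next2 s < 4].
Proof.
case: s => [[a b] c]; rewrite /now /next1 /next2 /=.
apply/idP/idP => [/allpairsP[[ab c'] [/allpairsP[[a' b'] [aP bP abE']] cP [abE cE]]]|].
  have [-> ->] : (a, b) = (a', b') by exact: etrans abE abE'.
  rewrite cE; move: aP bP cP; rewrite !mem_iota => /andP[_ a4] /andP[_ b4] /andP[_ c4].
  by apply/and3P; split.
move=> /and3P[a4 b4 c4].
apply/allpairsP; exists ((a, b), c); split; [|by rewrite mem_iota|by []].
by apply/allpairsP; exists (a, b); rewrite !mem_iota.
Qed.

Hypothesis good_bounded : forall b L R, good b L R ->
  (L \in all_streams) && (R \in all_streams).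
Hypothesis closedP : closed_rule.

Lemma closed_good b L R : good b L R -> closed_at b L R.
Proof.
move=> g; have /andP[LP RP] := good_bounded g.
have /andP[_ /allP H] := closedP.
have /allP HL : all (fun L => all (fun R => if good b L R then closed_at b L R else true)
    all_streams) all_streams by apply: H; case: (b).
by have := allP (HL _ LP) _ RP; rewrite g.
Qed.

Lemma mem_starts L : usable L -> L \in all_streams -> later L \in starts (now L).
Proof. by move=> uL LP; apply: map_f; rewrite mem_filter uL eqxx. Qed.

Lemma chain_long f m EL ER : f < 4 -> ~~ rigid f -> reach <= m ->
  EL \in starts f -> ER \in starts f -> chain K good f m EL ER.
Proof.
move=> f4 fx; have fl : closed_long f.
  have /andP[/allP H _] := closedP.
  by have := H f; rewrite mem_iota add0n f4 (negbTE fx); apply.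
move=> /subnK <-; elim: (m - reach) EL => [|n IH] EL ELs ERs.
  by have /andP[/allP/(_ _ ERs)] := allP fl _ ELs.
have /andP[_ /hasP[q qc /and3P[g1 g2 qs]]] := allP fl _ ELs.
by apply/hasP; exists q => //; rewrite g1 g2; exact: IH.
Qed.

Variable sz : nat -> nat.
Hypothesis lo_sz : forall f, f < 4 -> lo f <= sz f.
Hypothesis rigid_sz : forall f, f < 4 -> rigid f -> sz f = lo f.

Lemma closed_tops b L R : good b L R -> 0 < tops sz b (now L) /\
  chain K good (now L) (tops sz b (now L)).-1 (later L) (later R).
Proof.
move=> g; have /andP[LP RP] := good_bounded g.
have /and5P[uL uR /eqP LR n0 /allP nP] := closed_good g.
have f4 : now L < 4 by move: LP; rewrite mem_all_streams => /and3P[].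
have lsz := lo_sz f4; rewrite /tops; set n := lo _ - _ in n0 nP; split; first by lia.
case: ifP nP => fx nP; first by apply: nP; rewrite (rigid_sz f4 fx) inE.
have [mlong|longm] := ltnP (sz (now L) - (2 + ~~ b)).-1 reach.
  by apply: nP; rewrite mem_iota; lia.
apply: chain_long => //; [by rewrite fx|exact: mem_starts|].
by rewrite LR; exact: mem_starts.
Qed.

Variable row : bool -> seq (stream * stream).

Definition row_at b j := nth ((0, 0, 0), (0, 0, 0)) (row b) j.

(** The two lowest rows have period 4; a tile is given by its streams. *)
Definition rows_ok := all (fun j =>
  all (fun b => good false (row_at b j).1 (row_at b j).2 &&
    compat K (row_at b j).2 (row_at b (j.+1 %% 4)).1) [:: false; true] &&
  perm_eq [:: now (row_at true j).1; now (row_at true (j.+1 %% 4)).1;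
    now (row_at false (j.+1 %% 4)).1; now (row_at false j).1] K) (iota 0 4).

Hypothesis rowsP : rows_ok.

Lemma rows_at j : j < 4 ->
  [/\ forall b, good false (row_at b j).1 (row_at b j).2,
      forall b, compat K (row_at b j).2 (row_at b (j.+1 %% 4)).1 &
      perm_eq [:: now (row_at true j).1; now (row_at true (j.+1 %% 4)).1;
        now (row_at false (j.+1 %% 4)).1; now (row_at false j).1] K].
Proof.
move=> j4; have := allP rowsP j; rewrite mem_iota/= add0n => /(_ j4).
by move=> /andP[/and3P[/andP[g0 c0] /andP[g1 c1] _] p]; split => // -[].
Qed.

Definition phase (i : int) : nat := `|(i %% 4)%Z|%N.

Lemma phase_lt i : phase i < 4.
Proof. by rewrite /phase -ltz_nat gez0_abs ?modz_ge0// ltz_pmod. Qed.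

Lemma phase_succ i : phase (i + 1)%R = (phase i).+1 %% 4.
Proof. by rewrite /phase; lia. Qed.

Lemma closed_growth : inhabited (growth (map sz K)).
Proof.
pose base b i : state good := exist _ (false, row_at b (phase i))
  (let: And3 g _ _ := rows_at (phase_lt i) in g b).
apply: (@stream_growth K good sz _ _ _ base) => //.
- by move=> b L R /closed_good/and5P[_ _ /eqP].
- by move=> b L R /closed_tops[].
- by move=> b L R /closed_tops[].
- move=> b i; rewrite /sadj /base /lstream /rstream /= phase_succ.
  by have [_ + _] := rows_at (phase_lt i); apply.
- move=> i; rewrite /base /lstream /= phase_succ.
  by have [_ _] := rows_at (phase_lt i).
Qed.
End Closed.

Section Classes.
Definition const_stream (s : stream) := (next2 s == now s) && (next1 s != now s).

Definition boundedb (s : stream) := [&& now s < 4, next1 s < 4 & next2 s < 4].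

(** Sizes 4, 4, x, y with labels 0, 0, 1, 2.  Both sides of a tile continue
    alike, and one of any two consecutive labels of a stream is 0.  Over a
    quadrilateral stands a single x or y, as required by its only top side; over
    an x stand quadrilaterals, separated by triangles of size y. *)
Definition two_squares_rule (b : bool) (L R : stream) :=
  [&& boundedb L, boundedb R, L == R, const_stream L &
    if now L == 0 then ~~ b && (next1 L < 3) else (next1 L == 0) && (now L < 3)].

(** Four sizes that are at least 5, with labels 0, 1, 2, 3.  A trapezoid of size
    5 has two top sides, whose tiles meet at a vertex and so have different
    labels; hence the two sides of a trapezoid continue differently.  Triangles
    have three or more top sides, which can be filled in any case. *)
Definition no_square_rule (b : bool) (L R : stream) :=
  [&& boundedb L, boundedb R, now L == now R, const_stream L, const_stream R &
    b || (next1 L != next1 R)].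

(** The order of a pair of labels may only change if the pair contains 0. *)
Definition one_square_stream (s : stream) :=
  [&& next1 s != now s, next2 s != next1 s & [|| next2 s == now s, next2 s == 0 | now s == 0]].

(** One size is 4, with label 0, and the others, with labels 1, 2, 3, are at least
    5.  A quadrilateral trapezoid has a single tile on top, so its two sides
    continue alike; but that tile may have size 5, so that its own sides must
    continue differently.  Therefore exactly one side of a quadrilateral returns
    to 0.  The last condition keeps quadrilateral triangles possible: if neither
    side of a tile with two top sides continues with 0, the triangle between the
    two tiles on top has label 0, and its sides must continue differently. *)
Definition one_square_rule (b : bool) (L R : stream) :=
  [&& boundedb L, boundedb R, now L == now R, one_square_stream L, one_square_stream R &
    if b then (now L != 0) || (next1 L != next1 R)
    else if now L == 0 then (next1 L == next1 R) && ((next2 L == 0) (+) (next2 R == 0))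
    else (next1 L != next1 R) &&
      [|| next1 L == 0, next1 R == 0, next2 L != now L | next2 R != now R]].

Definition size4 a b c d := nth 0 [:: a; b; c; d].

Lemma two_squares_closed : closed_rule [:: 0; 0; 1; 2] two_squares_rule
  (fun s => const_stream s && ((now s == 0) && (next1 s < 3) || (next1 s == 0) && (now s < 3)))
  (fun=> 4) (pred1 0) 0.
Proof. by vm_compute. Qed.

Lemma no_square_closed : closed_rule [:: 0; 1; 2; 3] no_square_rule
  const_stream (fun=> 5) (fun=> false) 2.
Proof. by vm_compute. Qed.

Lemma one_square_closed : closed_rule [:: 0; 1; 2; 3] one_square_rule
  one_square_stream (size4 4 5 5 5) (pred1 0) 2.
Proof. by vm_compute. Qed.

Lemma boundedb_all s : boundedb s -> s \in all_streams.
Proof. by rewrite mem_all_streams. Qed.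

Lemma two_squares_growth x y : 4 <= x -> 4 <= y -> inhabited (growth [:: 4; 4; x; y]).
Proof.
move=> x4 y4; apply: (@closed_growth _ _ _ _ _ _ _ two_squares_closed (size4 4 x y 4) _ _
  (fun b => if b
    then [:: ((0, 1, 0), (0, 1, 0)); ((0, 2, 0), (0, 2, 0));
             ((0, 1, 0), (0, 1, 0)); ((0, 2, 0), (0, 2, 0))]
    else [:: ((1, 0, 1), (1, 0, 1)); ((2, 0, 2), (2, 0, 2));
             ((1, 0, 1), (1, 0, 1)); ((2, 0, 2), (2, 0, 2))]) _) => //.
- by move=> b L R /and5P[/boundedb_all-> /boundedb_all->].
- by do 4?[case=> //].
- by do 4?[case=> //].
Qed.

Lemma no_square_growth x y z w : 5 <= x -> 5 <= y -> 5 <= z -> 5 <= w ->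
  inhabited (growth [:: x; y; z; w]).
Proof.
move=> x5 y5 z5 w5; apply: (@closed_growth _ _ _ _ _ _ _ no_square_closed (size4 x y z w) _ _
  (fun b => if b
    then [:: ((0, 3, 0), (0, 2, 0)); ((1, 3, 1), (1, 2, 1));
             ((0, 3, 0), (0, 2, 0)); ((1, 3, 1), (1, 2, 1))]
    else [:: ((2, 1, 2), (2, 0, 2)); ((3, 1, 3), (3, 0, 3));
             ((2, 1, 2), (2, 0, 2)); ((3, 1, 3), (3, 0, 3))]) _) => //.
- by move=> b L R /and5P[/boundedb_all-> /boundedb_all->].
- by do 4?[case=> //].
Qed.

Lemma one_square_growth x y z : 5 <= x -> 5 <= y -> 5 <= z ->
  inhabited (growth [:: 4; x; y; z]).
Proof.
move=> x5 y5 z5; apply: (@closed_growth _ _ _ _ _ _ _ one_square_closed (size4 4 x y z) _ _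
  (fun b => if b
    then [:: ((0, 1, 0), (0, 1, 2)); ((2, 3, 0), (2, 1, 2));
             ((0, 3, 0), (0, 3, 2)); ((2, 1, 0), (2, 3, 2))]
    else [:: ((1, 0, 1), (1, 2, 1)); ((3, 0, 3), (3, 2, 3));
             ((1, 0, 1), (1, 2, 1)); ((3, 0, 3), (3, 2, 3))]) _) => //.
- by move=> b L R /and5P[/boundedb_all-> /boundedb_all->].
- by do 4?[case=> //].
- by do 4?[case=> //].
Qed.

(** The case depends on whether the size 4 occurs twice, once or not at all. *)
Lemma growth_perm (k : seq nat) : size k = 4 -> all (leq 4) k ->
  exists2 k', inhabited (growth k') & perm_eq k' k.
Proof.
move=> k4 kge; have [k4in|k4n] := boolP (4 \in k); last first.
  have ge5 : all (leq 5) k.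
    apply/allP => x xk; rewrite ltn_neqAle (allP kge _ xk) andbT.
    by apply: contraNneq k4n => ->.
  case: k k4 ge5 {kge k4n} => [|x [|y [|z [|w [|? ?]]]]] //= _ /and5P[? ? ? ? _].
  by exists [:: x; y; z; w] => //; exact: no_square_growth.
have pk := perm_to_rem k4in; move: k4 kge.
rewrite (perm_size pk) (perm_all _ pk) /=; set r := rem 4 k in pk *.
move=> [r3] rge; have [r4in|r4n] := boolP (4 \in r); last first.
  have ge5 : all (leq 5) r.
    apply/allP => x xk; rewrite ltn_neqAle (allP rge _ xk) andbT.
    by apply: contraNneq r4n => ->.
  rewrite perm_sym in pk.
  case: r r3 ge5 pk {rge r4n} => [|x [|y [|z [|? ?]]]] //= _ /and4P[? ? ? _] pk.
  by exists [:: 4; x; y; z] => //; exact: one_square_growth.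
have pr := perm_to_rem r4in; move: r3 rge.
rewrite (perm_size pr) (perm_all _ pr) /=.
have {}pk : perm_eq k [:: 4, 4 & rem 4 r].
  by apply: perm_trans pk _; rewrite perm_cons.
rewrite perm_sym in pk.
case: (rem 4 r) pk => [|x [|y [|? ?]]] //= pk _ /and3P[? ? _].
by exists [:: 4; 4; x; y] => //; exact: two_squares_growth.
Qed.
End Classes.

Local Close Scope nat_scope.
(** * Existence of the tiling *)

Lemma pseudo_homogeneous_perm (R : realType) (T : set (polygon R)) (k k' : seq nat) :
  perm_eq k k' -> pseudo_homogeneous_tiling T k -> pseudo_homogeneous_tiling T k'.
Proof.
move=> kk [tT vT]; split=> // v /vT[s sT sk]; exists s => //.
exact: perm_trans sk kk.
Qed.

Theorem proposition2p6 (R : realType) (k : 4.-tuple nat)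
    (k_ge4 : forall i : 'I_4, (4 <= tnth k i)%N)
    (theta_ge2 : 2 <= angle_sum k) :
  exists T : set (polygon R), pseudo_homogeneous_tiling T k.
Proof.
have kge : all (leq 4) k by apply/allP => x /tnthP[i ->].
have [k' [G] kk] := growth_perm (size_tuple k) kge.
have [T TP] := growth_tiling R G.
by exists T; exact: pseudo_homogeneous_perm TP.
Qed.
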